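(* Let $L\subset\mathbb{C}$ be a rank two lattice and let $L_\bullet\neq L_\circ$ be two full rank sublattices of $L$. Then $L_{\bullet\circ}:=L_\bullet\cap L_\circ$ is a full rank sublattice of both $L_\bullet$ and $L_\circ$, and the following equalities of rational functions hold: $$R_{L:L_{\bullet\circ}}=R_{L:L_\bullet}\circ R_{L_\bullet:L_{\bullet\circ}}=R_{L:L_\circ}\circ R_{L_\circ:L_{\bullet\circ}}.$$
   Context: A rank two lattice in $\mathbb{C}$ is a discrete subgroup of $\mathbb{C}$ of rank two; a full rank sublattice is a subgroup that is itself of rank two. For a rank two lattice $M$, $\wp(u|M)=u^{-2}+\sum_{0\ne v\in M}\left((u-v)^{-2}-v^{-2}\right)$ is the Weierstrass function of $M$. For a full rank sublattice $N\subset M$, $R_{M:N}$ denotes the unique rational function (of degree equal to the index $|M:N|$) such that $R_{M:N}(\wp(u|N))=\wp(u|M)$ for all $u$; it is the coordinate expression of the natural holomorphic map $\mathbb{C}/N^+\to\mathbb{C}/M^+$, where $M^+$ is the group of transformations of $\mathbb{C}$ generated by translations by elements of $M$ and by $u\mapsto -u$. *)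

(* Defs.v *)
From HB Require Import structures.
From mathcomp Require Import all_boot all_order all_algebra.
From mathcomp Require Import generic_quotient complex.
From mathcomp Require Import all_classical all_reals all_analysis.
From mathcomp Require Import showcase.summability.

Set Implicit Arguments.
Unset Strict Implicit.
Unset Printing Implicit Defensive.

Import Order.TTheory GRing.Theory Num.Theory.
Import numFieldNormedType.Exports.

Local Open Scope classical_set_scope.
Local Open Scope ring_scope.
Local Open Scope quotient_scope.

Section Lattices.
Variable R : realType.
Local Notation C := (R[i]).
Implicit Types (M N : set C).

Definition subgroup M : Prop :=
  M 0 /\ forall x y, M x -> M y -> M (x - y).

Definition Zindependent n (v : 'I_n -> C) : Prop :=
  forall c : 'I_n -> int, \sum_i v i *~ c i = 0 -> forall i, c i = 0.

(* The maximal number of Z-independent elements of M is n. *)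
Definition has_rank n M : Prop :=
  (exists2 v : 'I_n -> C, (forall i, M (v i)) & Zindependent v) /\
  (forall v : 'I_n.+1 -> C, (forall i, M (v i)) -> ~ Zindependent v).

Definition discrete M : Prop := M `<=` isolated (M : set C^o).

Definition rank2_lattice M : Prop :=
  [/\ subgroup M, discrete M & has_rank 2 M].

Definition full_rank_sublattice N M : Prop :=
  [/\ subgroup N, N `<=` M & has_rank 2 N].

(* The Riemann sphere, None being the point at infinity. *)
Definition P1 : Type := option C.

(* The series is summed unconditionally: sum is the limit over the net of
   finite subsets of C, the terms off M \ {0} being 0. *)
Definition wp M (u : C) : P1 :=
  if u \in M then None else
  Some (u ^- 2 +
    sum (fun v : C =>
      (if v \in M `\ 0 then (u - v) ^- 2 - v ^- 2 else 0) : C^o)).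

End Lattices.

Section RationalFunctions.
Variable F : fieldType.
Implicit Types (f g : {fraction {poly F}}).

Definition ratnum f : {poly F} :=
  let r := frac (repr f) in r.1 %/ gcdp r.1 r.2.

Definition ratden f : {poly F} :=
  let r := frac (repr f) in r.2 %/ gcdp r.1 r.2.

(* The map of the projective line induced by f. Poles are detected by the
   denominator alone because ratnum f and ratden f are coprime. *)
Definition rateval f (z : option F) : option F :=
  let p := ratnum f in let q := ratden f in
  match z with
  | Some x => if q.[x] == 0 then None else Some (p.[x] / q.[x])
  | None => if (size q < size p)%N then None
            else Some (p`_(size q).-1 / lead_coef q)
  end.

Definition ratconst (a : F) : {fraction {poly F}} :=
  FracField.tofrac a%:P.

(* f o g, by substituting g for the variable in f. If g is a constant at which
   f has a pole then f o g is not a rational function, and the value is 0. *)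
Definition ratcomp f g : {fraction {poly F}} :=
  (map_poly ratconst (ratnum f)).[g] / (map_poly ratconst (ratden f)).[g].

End RationalFunctions.

(* R_{M:N}. At most one f has this property, since wp N takes infinitely many
   values; that one exists, of degree |M:N|, is classical for N of full rank. *)
Definition ratR (R : realType) (M N : set R[i]) : {fraction {poly R[i]}} :=
  xget 0 [set f : {fraction {poly R[i]}} |
    forall u : R[i], rateval f (wp N u) = wp M u].

(* Main.v *)
Require Import Defs.
From mathcomp Require Import all_boot all_order all_algebra.
From mathcomp Require Import generic_quotient complex.
From mathcomp Require Import all_classical all_reals all_analysis.
From mathcomp Require Import finmap ring lra.
From mathcomp Require Import showcase.summability.

Set Implicit Arguments.
Unset Strict Implicit.
Unset Printing Implicit Defensive.

Import Order.TTheory GRing.Theory Num.Theory.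
Import numFieldNormedType.Exports.

Local Open Scope classical_set_scope.
Local Open Scope ring_scope.
Local Open Scope quotient_scope.

(* Let N be a subgroup of finite index in the lattice M. Summing over cosets,
   wp_M(u) differs by a constant from the sum of the wp_N(u - c), c running over
   representatives of M/N, hence 2 wp_M(u) is up to a constant the sum of the
   wp_N(u + c) + wp_N(u - c). Each of these is a rational function of
   x = wp_N(u): the product of (x - wp_N(c))^2 with wp_N(u + c) + wp_N(u - c) is
   a quadratic polynomial in x, because the difference with a suitable quadratic
   polynomial has no pole, is periodic, and is constant by the maximum modulus
   principle. So R_{M:N} exists. It is unique, since wp_N takes infinitely many
   values, and therefore compatible with composition. The intersection has rank
   two because a sublattice of full rank contains a nonzero multiple of every
   element of L. *)

(** * Unconditional sums of complex families *)

(** The analysis rests on power series alone, without integrals: a function is regular at a point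
    when its Taylor remainders of all orders obey one geometric bound. This condition survives
    products and sums of families with summable bounds, and it already yields isolated zeros and the
    maximum modulus principle. The combination wp_N(u + c) + wp_N(u - c) replaces a single translate
    because it is even in u; a single translate is in general not even, hence no function of
    wp_N(u). By evenness only even powers occur in the expansion at 0, so two constants remove the
    poles of order 4 and 2, while the factor (x - wp_N(c))^2 cancels the double poles at c and -c. A
    last obstacle is that R_{M:N} is specified by its values on the whole sphere. The relation
    Q(wp_N) wp_M = P(wp_N) is obtained only off M, and P and Q may share factors. The fraction is
    therefore reduced, and its values at the points of M are recovered from growth at the poles. *)

Section NetSums.
Variable R : realType.
Local Notation C := (R[i]).
Implicit Types (x y z u v : C) (f g : C -> C).

(** The norm of [R[i]] takes its values in [R[i]]; a modulus with values in [R] gives access to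
    suprema and to real arithmetic. *)
Definition cabs (z : C) : R := complex.Re `|z|.

Lemma cabsE z : `|z| = (cabs z)%:C%C.
Proof. by rewrite /cabs RRe_real // normr_real. Qed.

Lemma cabsK z : cabs z = Num.sqrt (complex.Re z ^+ 2 + complex.Im z ^+ 2).
Proof. by rewrite /cabs normc_def. Qed.

Lemma cabs_ge0 z : 0 <= cabs z.
Proof. by rewrite -lecR -cabsE normr_ge0. Qed.

Lemma cabs0 : cabs 0 = 0. Proof. by rewrite /cabs normr0. Qed.
Lemma cabs1 : cabs 1 = 1. Proof. by rewrite /cabs normr1. Qed.
Lemma cabsN z : cabs (- z) = cabs z. Proof. by rewrite /cabs normrN. Qed.

Lemma cabsM z u : cabs (z * u) = cabs z * cabs u.
Proof.
by rewrite {1}/cabs normrM !cabsE -rmorphM.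
Qed.

Lemma cabsX z n : cabs (z ^+ n) = cabs z ^+ n.
Proof. by elim: n => [|n IH]; rewrite ?expr0 ?cabs1 // !exprS cabsM IH. Qed.

Lemma cabsV z : cabs z^-1 = (cabs z)^-1.
Proof. by rewrite {1}/cabs normfV !cabsE -fmorphV. Qed.

Lemma cabsD z u : cabs (z + u) <= cabs z + cabs u.
Proof. by rewrite -lecR rmorphD /= -!cabsE ler_normD. Qed.

Lemma cabsB z u : cabs (z - u) <= cabs z + cabs u.
Proof. by rewrite (le_trans (cabsD _ _)) // cabsN. Qed.

Lemma cabsC z u : cabs (z - u) = cabs (u - z).
Proof. by rewrite -cabsN opprB. Qed.

Lemma cabsBr z u : cabs z - cabs u <= cabs (z + u).
Proof. by rewrite lerBlDr -(cabsN u) (le_trans _ (cabsD _ _)) // addrK. Qed.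

Lemma cabs_eq0 z : (cabs z == 0) = (z == 0).
Proof.
apply/eqP/eqP => [h|->]; last exact: cabs0.
by apply/normr0_eq0; rewrite cabsE h.
Qed.

Lemma cabs_gt0 z : (0 < cabs z) = (z != 0).
Proof. by rewrite lt_neqAle cabs_ge0 andbT eq_sym cabs_eq0. Qed.

Lemma cabs_real (r : R) : cabs (r%:C%C) = `|r|.
Proof. by rewrite cabsK /= expr0n /= addr0 sqrtr_sqr. Qed.

Lemma cabs_nat n : cabs n%:R = n%:R.
Proof. by rewrite -[n%:R](rmorph_nat (real_complex R)) cabs_real normr_nat. Qed.

Lemma cabs_Re z : `|complex.Re z| <= cabs z.
Proof. by rewrite cabsK -sqrtr_sqr ler_wsqrtr // lerDl sqr_ge0. Qed.

Lemma cabs_Im z : `|complex.Im z| <= cabs z.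
Proof. by rewrite cabsK -sqrtr_sqr ler_wsqrtr // lerDr sqr_ge0. Qed.

Lemma cabs_le_ReIm z : cabs z <= `|complex.Re z| + `|complex.Im z|.
Proof.
rewrite cabsK -(ler_pXn2r (n := 2)) ?nnegrE ?sqrtr_ge0 ?addr_ge0 //.
rewrite sqr_sqrtr ?addr_ge0 ?sqr_ge0 //.
rewrite -(real_normK (num_real (complex.Re z))) -(real_normK (num_real (complex.Im z))).
have := normr_ge0 (complex.Re z); have := normr_ge0 (complex.Im z); nra.
Qed.

Lemma cabs_sum (I : Type) (r : seq I) (P : pred I) (F : I -> C) :
  cabs (\sum_(i <- r | P i) F i) <= \sum_(i <- r | P i) cabs (F i).
Proof.
elim/big_ind2 : _ => [|a b c d h1 h2|//]; first by rewrite cabs0.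
by rewrite (le_trans (cabsD _ _)) // lerD.
Qed.

Local Open Scope fset_scope.
Local Open Scope ring_scope.

(** The limit over the net of finite subsets in epsilon form; [has_sum_sum] returns to
    [summability.sum]. *)
Definition has_sum f (s : C) : Prop :=
  forall e : R, 0 < e -> exists A : {fset C}, forall B : {fset C},
    A `<=` B -> cabs (\sum_(i <- B) f i - s) < e.

Lemma eq_has_sum f g s : f =1 g -> has_sum f s -> has_sum g s.
Proof. by move=> /funext ->. Qed.

Lemma has_sum_uniq f s t : has_sum f s -> has_sum f t -> s = t.
Proof.
move=> hs ht; apply/eqP; apply/negPn/negP => ne.
have e0 : 0 < cabs (s - t) / 2 by rewrite divr_gt0 // cabs_gt0 subr_eq0.
have [A hA] := hs _ e0; have [B hB] := ht _ e0.
have := hA _ (fsubsetUl A B); have := hB _ (fsubsetUr A B).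
set S := \sum_(_ <- _) _ => h1 h2.
have : cabs (s - t) <= cabs (S - t) + cabs (S - s).
  by rewrite (_ : s - t = (S - t) - (S - s)) ?cabsB //; ring.
lra.
Qed.

Lemma has_sumD f g s t :
  has_sum f s -> has_sum g t -> has_sum (fun v => f v + g v) (s + t).
Proof.
move=> hs ht e e0; have e2 : 0 < e / 2 by rewrite divr_gt0.
have [A hA] := hs _ e2; have [B hB] := ht _ e2.
exists (A `|` B) => D; rewrite fsubUset => /andP[/hA h1 /hB h2].
rewrite big_split /= opprD addrACA (le_lt_trans (cabsD _ _)) //; lra.
Qed.

Lemma has_sum0 : has_sum (fun=> 0) 0.
Proof. by move=> e e0; exists fset0 => B _; rewrite big1 // subr0 cabs0. Qed.

Lemma has_sumZ a f s : has_sum f s -> has_sum (fun v => a * f v) (a * s).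
Proof.
move=> hs e e0; have [->|a0] := eqVneq a 0.
  exists fset0 => B _; rewrite mul0r subr0 big1 ?cabs0 // => v _; exact: mul0r.
have a1 : 0 < cabs a by rewrite cabs_gt0.
have [A hA] := hs _ (divr_gt0 e0 a1).
exists A => B /hA h; rewrite -mulr_sumr -mulrBr cabsM mulrC.
by rewrite -ltr_pdivlMr.
Qed.

Lemma has_sumN f s : has_sum f s -> has_sum (fun v => - f v) (- s).
Proof.
by move=> /(has_sumZ (-1)); rewrite mulN1r; apply: eq_has_sum => v; rewrite mulN1r.
Qed.

Lemma has_sumB f g s t :
  has_sum f s -> has_sum g t -> has_sum (fun v => f v - g v) (s - t).
Proof. by move=> hs /has_sumN; exact: has_sumD. Qed.

Lemma has_sum_big (I : Type) (r : seq I) (F : I -> C -> C) (s : I -> C) :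
  (forall i, has_sum (F i) (s i)) ->
  has_sum (fun v => \sum_(i <- r) F i v) (\sum_(i <- r) s i).
Proof.
move=> h; elim: r => [|i r IH].
  by rewrite big_nil; apply: eq_has_sum has_sum0 => v; rewrite big_nil.
rewrite big_cons; apply: eq_has_sum (has_sumD (h i) IH) => v.
by rewrite big_cons.
Qed.

Lemma has_sum_bij (p q : C -> C) f s :
  cancel p q -> cancel q p -> has_sum f s -> has_sum (f \o p) s.
Proof.
move=> pK qK hs e e0; have [A hA] := hs e e0.
exists [fset q x | x in A] => B hB.
have := hA [fset p x | x in B].
rewrite big_imfset /=; last by move=> x y _ _; exact: (can_inj pK).
apply; apply/fsubsetP => x xA; apply/imfsetP; exists (q x) => //=.
by apply: (fsubsetP hB); exact: in_imfset.
Qed.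

Lemma has_sum_bound f s (M : R) :
  (forall B : {fset C}, \sum_(i <- B) cabs (f i) <= M) ->
  has_sum f s -> cabs s <= M.
Proof.
move=> hM hs; apply/ler_addgt0Pr => e e0; have [A hA] := hs e e0.
have := hA A (fsubset_refl _); set S := \sum_(_ <- _) _ => h.
have := cabsB S (S - s); rewrite opprB addrC subrK => hS.
have := le_trans (cabs_sum _ _ _) (hM A); rewrite -/S; lra.
Qed.

Lemma has_sum_nneg (f : C -> R) (M : R) :
  (forall v, 0 <= f v) -> (forall B : {fset C}, \sum_(i <- B) f i <= M) ->
  exists s, has_sum (fun v => (f v)%:C%C) s.
Proof.
move=> f0 hM; pose E := [set \sum_(i <- B) f i | B in [set: {fset C}]].
have hE : has_sup E.
  by split; [exists (\sum_(i <- fset0) f i), fset0 | exists M => _ [B _ <-]].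
exists (sup E)%:C%C => e e0.
have [_ [A _ <-] hA] := sup_adherent e0 hE.
exists A => B AB; rewrite -raddf_sum /= -rmorphB /= cabs_real.
have h1 : \sum_(i <- A) f i <= \sum_(i <- B) f i.
  pose G i := if i \in A then f i else 0.
  have -> : \sum_(i <- A) f i = \sum_(i <- A) G i.
    by rewrite big_seq [RHS]big_seq; apply: eq_bigr => i iA; rewrite /G iA.
  rewrite (big_fset_incl _ AB); last by move=> x _ /negbTE xA; rewrite /G xA.
  by apply: ler_sum => i _; rewrite /G; case: ifP.
have h2 : \sum_(i <- B) f i <= sup E by apply: ub_le_sup; [exact: hE.2|exists B].
rewrite ler0_norm; lra.
Qed.

(** The real and imaginary parts are each written as (h + |h|) - |h|, a difference of nonnegative
    families, whose sums are suprema of finite partial sums. *)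
Lemma has_sum_dom f (M : R) :
  (forall B : {fset C}, \sum_(i <- B) cabs (f i) <= M) -> exists s, has_sum f s.
Proof.
move=> hM.
have key (h : C -> R) : (forall v, `|h v| <= cabs (f v)) ->
    exists s, has_sum (fun v => (h v)%:C%C) s.
  move=> hf.
  have [s1 hs1] : exists s, has_sum (fun v => (h v + `|h v|)%:C%C) s.
    apply: (@has_sum_nneg _ (M + M)) => [v|B].
      by have := lerNnormlW (lexx `|h v|); lra.
    apply: le_trans (lerD (hM B) (hM B)); rewrite -big_split /=.
    apply: ler_sum => v _; have := ler_norm (h v); have := hf v; lra.
  have [s2 hs2] : exists s, has_sum (fun v => `|h v|%:C%C) s.
    apply: (@has_sum_nneg _ M) => // B; apply: le_trans (hM B).
    exact: ler_sum.
  exists (s1 - s2); apply: eq_has_sum (has_sumB hs1 hs2) => v.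
  by rewrite -rmorphB /= addrK.
have [s1 hs1] := key _ (fun v => cabs_Re (f v)).
have [s2 hs2] := key _ (fun v => cabs_Im (f v)).
exists (s1 + 'i%C * s2); apply: eq_has_sum (has_sumD hs1 (has_sumZ 'i%C hs2)) => v.
by rewrite -complexE; case: (f v).
Qed.

Lemma has_sum_sum f s : has_sum f s -> summability.sum (f : C -> C^o) = s.
Proof.
move=> hs; rewrite /summability.sum; apply: cvg_lim.
  exact: norm_hausdorff.
  exact: totally_filter.
have FF : Filter (@totally C) by exact: (@totally_filter C).
apply/cvgrPdist_lt => e e0.
have e1 : 0 < complex.Re e by move: e0; rewrite ltcE /= => /andP[].
have ee : e = (complex.Re e)%:C%C by rewrite RRe_real // gtr0_real.
have [A hA] := hs _ e1.
exists A => // B /= AB.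
rewrite distrC /partial_sum -(big_seq_fsetE _ _ xpredT f) /=.
rewrite ee; move: (hA B AB); rewrite -ltcR -cabsE //.
Qed.

End NetSums.

(** * Analytic germs *)

Section Germs.
Variable R : realType.
Local Notation C := (R[i]).
Implicit Types (a z u v : C) (f g : C -> C) (s t : nat -> C).

Definition taylor s n z : C := \sum_(k < n) s k * z ^+ k.

(* Cauchy-type remainder estimates, uniform in the order n, replace convergence
   of the Taylor series. The point z = 0 is excluded, so that f is only
   required to be regular at a after a removable singularity is filled in. *)
Definition germ_bound f a s (B K : R) : Prop :=
  0 < K /\ forall n z, z != 0 -> K * cabs z <= 1 ->
    cabs (f (a + z) - taylor s n z) <= B * (K * cabs z) ^+ n.

Definition germ f a s : Prop := exists B K, germ_bound f a s B K.

Lemma taylorS s n z : taylor s n.+1 z = taylor s n z + s n * z ^+ n.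
Proof. by rewrite /taylor big_ord_recr. Qed.

Lemma taylor0 s z : taylor s 0 z = 0.
Proof. by rewrite /taylor big_ord0. Qed.

Lemma cabs_exists (r : R) : 0 < r -> exists2 z : C, z != 0 & cabs z = r.
Proof.
move=> r0; have e : cabs (r%:C%C : C) = r by rewrite cabs_real gtr0_norm.
by exists r%:C%C => //; rewrite -cabs_eq0 e gt_eqF.
Qed.

Lemma germ_bound_ge0 f a s B K : germ_bound f a s B K -> 0 <= B.
Proof.
move=> [K0 h]; have K1 : 0 < K^-1 by rewrite invr_gt0.
have [z z0 ez] := cabs_exists K1.
have := h 0%N z z0; rewrite ez mulfV ?gt_eqF // lexx => /(_ isT).
by rewrite expr0 mulr1; apply: le_trans; exact: cabs_ge0.
Qed.

Lemma germ_bound_le f a s B K B' K' : B <= B' -> K <= K' ->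
  germ_bound f a s B K -> germ_bound f a s B' K'.
Proof.
move=> BB KK h; have B0 := germ_bound_ge0 h; have [K0 {}h] := h; split; first lra.
move=> n z z0 hz.
have h0 : K * cabs z <= K' * cabs z by rewrite ler_wpM2r // cabs_ge0.
have h1 : 0 <= K * cabs z by rewrite mulr_ge0 ?cabs_ge0 // ltW.
apply: (le_trans (h n z z0 (le_trans h0 hz))).
by apply: ler_pM; rewrite ?exprn_ge0 // lerXn2r // nnegrE; lra.
Qed.

(** Cauchy's estimate: the term of order n is the difference of the remainders of orders n and n +
    1, each at most [B] on the circle of radius 1/K. *)
Lemma germ_coef f a s B K n : germ_bound f a s B K -> cabs (s n) <= 2 * B * K ^+ n.
Proof.
move=> h; have B0 := germ_bound_ge0 h; have [K0 {}h] := h.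
have K1 : 0 < K^-1 by rewrite invr_gt0.
have [z z0 ez] := cabs_exists K1.
have hz : K * cabs z = 1 by rewrite ez mulfV ?gt_eqF.
have := h n z z0; have := h n.+1 z z0; rewrite hz lexx !expr1n => /(_ isT) h1 /(_ isT) h2.
have : cabs (s n * z ^+ n) <= 2 * B.
  have -> : s n * z ^+ n = (f (a + z) - taylor s n z) - (f (a + z) - taylor s n.+1 z).
    by rewrite taylorS; ring.
  by rewrite (le_trans (cabsB _ _)) //; lra.
by rewrite cabsM cabsX ez exprVn ler_pdivrMr // exprn_gt0.
Qed.

Lemma germ_ext f g a s (r : R) : 0 < r ->
  (forall z, z != 0 -> cabs z <= r -> f (a + z) = g (a + z)) ->
  germ f a s -> germ g a s.
Proof.
move=> r0 fg [B [K h]]; exists B, (Num.max K r^-1).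
have KK : K <= Num.max K r^-1 by rewrite le_max lexx.
have [K0 {}h] := germ_bound_le (lexx B) KK h.
split=> // n z z0 hz; rewrite -fg //; first exact: h.
rewrite -[r]invrK -div1r ler_pdivlMr ?invr_gt0 // mulrC; apply: le_trans hz.
by rewrite ler_wpM2r ?cabs_ge0 // le_max lexx orbT.
Qed.

Lemma eq_germ f g a s : f =1 g -> germ f a s -> germ g a s.
Proof. by move=> /funext ->. Qed.

Lemma germ_common f a s g b t : germ f a s -> germ g b t ->
  exists B K, germ_bound f a s B K /\ germ_bound g b t B K.
Proof.
move=> [B [K h]] [B' [K' h']]; exists (Num.max B B'), (Num.max K K').
by split; [apply: germ_bound_le h|apply: germ_bound_le h']; rewrite le_max lexx ?orbT.
Qed.

Lemma germD f g a s t : germ f a s -> germ g a t ->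
  germ (fun z => f z + g z) a (fun k => s k + t k).
Proof.
move=> hs ht; have [B [K [[K0 h1] [_ h2]]]] := germ_common hs ht.
exists (2 * B), K; split=> // n z z0 hz.
have -> : taylor (fun k => s k + t k) n z = taylor s n z + taylor t n z.
  by rewrite /taylor -big_split; apply: eq_bigr => k _; rewrite mulrDl.
rewrite opprD addrACA (le_trans (cabsD _ _)) //.
by have := h1 n z z0 hz; have := h2 n z z0 hz; lra.
Qed.

Lemma germ_cst a (c : C) : germ (fun=> c) a (fun k => if k is 0 then c else 0).
Proof.
exists (cabs c), 1; split=> // n z z0; rewrite mul1r => hz.
case: n => [|n]; first by rewrite taylor0 subr0 expr0 mulr1.
rewrite /taylor big_ord_recl big1 /= => [|k _]; last by rewrite mul0r.
by rewrite expr0 mulr1 addr0 subrr cabs0 mulr_ge0 ?exprn_ge0 ?cabs_ge0.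
Qed.

Definition cauchy s t k : C := \sum_(i < k.+1) s i * t (k - i)%N.

Lemma taylor_cauchy s t n z :
  taylor (cauchy s t) n z = \sum_(i < n) s i * z ^+ i * taylor t (n - i) z.
Proof.
elim: n => [|n IH]; first by rewrite taylor0 big_ord0.
rewrite taylorS IH [in RHS]big_ord_recr /= subSnn.
rewrite (_ : \sum_(i < n) s i * z ^+ i * taylor t (n.+1 - i) z =
  \sum_(i < n) s i * z ^+ i * taylor t (n - i) z +
  \sum_(i < n) s i * t (n - i)%N * z ^+ n).
  rewrite -addrA; congr (_ + _); rewrite /cauchy big_ord_recr /= subnn mulrDl mulr_suml.
  by rewrite taylorS taylor0 add0r expr0 mulr1; congr (_ + _); ring.
rewrite -big_split; apply: eq_bigr => i _ /=.
rewrite subSn ?taylorS ?(ltnW (ltn_ord i)) // mulrDr; congr (_ + _).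
rewrite mulrACA -exprD subnKC // ltnW //.
Qed.

Lemma germM f g a s t : germ f a s -> germ g a t ->
  germ (fun z => f z * g z) a (cauchy s t).
Proof.
move=> hs ht; have [B [K [h1 h2]]] := germ_common hs ht.
have B0 := germ_bound_ge0 h1; have cs i := germ_coef i h1.
have [K0 {}h1] := h1; have {}h2 := h2.2.
(* Doubling [K] absorbs the growth in n: the error terms add up to at most (2n + 1) B^2 x^n, and 2n
   + 1 <= 3 * 2^n. *)
exists (3 * B * B), (2 * K); split=> [|n z z0]; first by rewrite mulr_gt0.
rewrite -mulrA; set x := K * cabs z => hx.
have x0 : 0 <= x by rewrite mulr_ge0 ?cabs_ge0 // ltW.
have x1 : x <= 1 by lra.
rewrite taylor_cauchy.
have -> : f (a + z) * g (a + z) - \sum_(i < n) s i * z ^+ i * taylor t (n - i) z =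
  (f (a + z) - taylor s n z) * g (a + z) +
   \sum_(i < n) s i * z ^+ i * (g (a + z) - taylor t (n - i) z).
  under [in RHS]eq_bigr do rewrite mulrBr.
  rewrite big_split /= sumrN -mulr_suml -/(taylor s n z); ring.
rewrite (le_trans (cabsD _ _)) //.
have hg : cabs (g (a + z)) <= B by have := h2 0%N z z0 x1; rewrite taylor0 subr0 expr0 mulr1.
have e1 : cabs ((f (a + z) - taylor s n z) * g (a + z)) <= B * B * x ^+ n.
  rewrite cabsM mulrAC ler_pM ?cabs_ge0 //; exact: h1.
have e2 : cabs (\sum_(i < n) s i * z ^+ i * (g (a + z) - taylor t (n - i) z)) <=
    n%:R * (2 * B * B * x ^+ n).
  rewrite (le_trans (cabs_sum _ _ _)) //.
  rewrite -[n in n%:R](card_ord n) -sumr_const mulr_suml; apply: ler_sum => i _.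
  rewrite mul1r cabsM.
  have -> : 2 * B * B * x ^+ n = 2 * B * x ^+ i * (B * x ^+ (n - i)).
    by rewrite -[in LHS](subnKC (ltnW (ltn_ord i))) exprD; ring.
  apply: ler_pM; rewrite ?cabs_ge0 //; last exact: h2.
  rewrite cabsM cabsX /x exprMn mulrA ler_wpM2r ?exprn_ge0 ?cabs_ge0 //.
rewrite exprMn.
have e3 : n%:R + 1 <= 2 ^+ n :> R.
  by rewrite natr1 -natrX ler_nat ltn_expl.
have xn : 0 <= B * B * x ^+ n by rewrite !mulr_ge0 // exprn_ge0.
have := mulr_ge0 xn (_ : 0 <= 2 ^+ n - (n%:R + 1)).
rewrite subr_ge0 => /(_ e3) h5.
have := mulr_ge0 (ler0n R n) xn.
move: e1 e2 h5 xn; set X := x ^+ n; set Y := 2 ^+ n; set N : R := n%:R; nra.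
Qed.

Lemma germN f a s : germ f a s -> germ (fun z => - f z) a (fun k => - s k).
Proof.
move=> [B [K [K0 h]]]; exists B, K; split=> // n z z0 hz.
have -> : taylor (fun k => - s k) n z = - taylor s n z.
  by rewrite /taylor -sumrN; apply: eq_bigr => k _; rewrite mulNr.
by rewrite -opprD cabsN h.
Qed.

Lemma germB f g a s t : germ f a s -> germ g a t ->
  germ (fun z => f z - g z) a (fun k => s k - t k).
Proof. by move=> hs /germN; exact: germD. Qed.

Lemma germ_shift f a s : germ f a s ->
  germ (fun z => (f z - s 0%N) / (z - a)) a (fun k => s k.+1).
Proof.
move=> [B [K [K0 h]]]; exists (B * K), K; split=> // n z z0 hz.
have cz : 0 < cabs z by rewrite cabs_gt0.
rewrite (addrC a) addrK (addrC z).
have tE : taylor s n.+1 z = s 0%N + z * taylor (fun k => s k.+1) n z.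
  rewrite /taylor big_ord_recl expr0 mulr1 mulr_sumr; congr (_ + _).
  by apply: eq_bigr => k _; rewrite /= /bump add1n exprS; ring.
have -> : (f (a + z) - s 0%N) / z - taylor (fun k => s k.+1) n z =
          (f (a + z) - taylor s n.+1 z) / z by rewrite tE; field.
rewrite cabsM cabsV ler_pdivrMr // (le_trans (h n.+1 z z0 hz)) // exprSr.
by rewrite le_eqVlt; apply/orP; left; apply/eqP; ring.
Qed.

Lemma germ_id a : exists2 s, germ (fun z => z - a) a s & s 0%N = 0.
Proof.
exists (fun k => if k == 1%N then 1 else 0) => //.
exists 1, 1; split=> // n z z0; rewrite !mul1r => hz.
rewrite (addrC a) addrK; case: n => [|[|n]].
- by rewrite taylor0 subr0 expr0.
- by rewrite taylorS taylor0 mul0r addr0 subr0 expr1.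
rewrite /taylor !big_ord_recl big1 /= => [|k _]; last by rewrite mul0r.
by rewrite mul0r add0r addr0 mul1r expr1 subrr cabs0 exprn_ge0 ?cabs_ge0.
Qed.

Lemma germ_translate f a b s : germ f (a + b) s -> germ (fun z => f (z + b)) a s.
Proof.
move=> [B [K [K0 h]]]; exists B, K; split=> // n z z0 hz.
by rewrite addrAC h.
Qed.

Lemma germ_opp f a s : germ f (- a) s ->
  germ (fun z => f (- z)) a (fun k => (-1) ^+ k * s k).
Proof.
move=> [B [K [K0 h]]]; exists B, K; split=> // n z z0 hz.
have := h n (- z); rewrite oppr_eq0 cabsN => /(_ z0 hz); rewrite opprD.
rewrite (_ : taylor s n (- z) = taylor (fun k => (-1) ^+ k * s k) n z) //.
by apply: eq_bigr => k _; rewrite (exprNn z) mulrA [s k * _]mulrC.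
Qed.

Lemma germ_cvg f a s (e : R) : germ f a s -> 0 < e ->
  exists2 r : R, 0 < r & forall z, z != 0 -> cabs z <= r -> cabs (f (a + z) - s 0%N) < e.
Proof.
move=> [B [K h]] e0; have B0 := germ_bound_ge0 h; have [K0 {}h] := h.
have D0 : 0 < B * K + 1 by rewrite ltr_wpDl // mulr_ge0 // ltW.
exists (Num.min K^-1 (e / (B * K + 1))).
  by rewrite lt_min invr_gt0 K0 divr_gt0.
move=> z z0; rewrite le_min => /andP[h1 h2].
have cz : 0 < cabs z by rewrite cabs_gt0.
have := h 1%N z z0; rewrite taylorS taylor0 add0r expr0 mulr1 expr1 => /(_ _)/le_lt_trans.
apply; first by rewrite mulrC -ler_pdivlMr // div1r.
move: h2; rewrite ler_pdivlMr //; nra.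
Qed.

Lemma small_eq0 (c : C) (B r : R) : 0 < r ->
  (forall z : C, z != 0 -> cabs z <= r -> cabs c <= B * cabs z) -> c = 0.
Proof.
move=> r0 h; apply/eqP; rewrite -cabs_eq0 eq_le cabs_ge0 andbT.
apply/ler_addgt0Pr => e e0; rewrite add0r.
have D0 : 0 < `|B| + 1 by rewrite ltr_wpDl.
have m0 : 0 < Num.min r (e / (`|B| + 1)) by rewrite lt_min r0 divr_gt0.
have [z z0 ez] := cabs_exists m0.
have zr : cabs z <= r by rewrite ez ge_min lexx.
have ze : cabs z <= e / (`|B| + 1) by rewrite ez ge_min lexx orbT.
apply: (le_trans (h z z0 zr)); move: ze; rewrite ler_pdivlMr //.
have := ler_norm B; have := cabs_ge0 z; nra.
Qed.

Lemma germ0_eq0 a s : germ (fun=> 0) a s -> forall k, s k = 0.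
Proof.
move=> [B [K [K0 h]]]; elim/ltn_ind => m IH.
have r0 : 0 < K^-1 by rewrite invr_gt0.
apply: (@small_eq0 _ (B * K ^+ m.+1) _ r0) => z z0 hz.
have cz : 0 < cabs z by rewrite cabs_gt0.
have := h m.+1 z z0; rewrite mulrC -ler_pdivlMr // div1r => /(_ hz).
rewrite taylorS {1}/taylor big1 => [|k _]; last by rewrite IH ?mul0r.
rewrite /= !add0r cabsN cabsM cabsX exprMn (exprSr (cabs z)) => h1.
rewrite -(ler_pM2r (exprn_gt0 m cz)) (le_trans h1) // le_eqVlt.
by apply/orP; left; apply/eqP; ring.
Qed.

Lemma germ_uniq f a s t : germ f a s -> germ f a t -> s =1 t.
Proof.
move=> hs ht k; apply/eqP; rewrite -subr_eq0; apply/eqP.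
have h : germ (fun=> 0) a (fun k => s k - t k).
  by apply: eq_germ (germB hs ht) => z; rewrite subrr.
exact: germ0_eq0 h k.
Qed.

Lemma germ_even f s : (forall z, f (- z) = f z) -> germ f 0 s ->
  forall k, odd k -> s k = 0.
Proof.
move=> fe hs k ok.
have h : germ f 0 (fun k => (-1) ^+ k * s k).
  by apply: eq_germ fe _; apply: germ_opp; rewrite oppr0.
have := germ_uniq hs h k; rewrite -signr_odd ok expr1 mulN1r => /eqP.
by rewrite -addr_eq0 -mulr2n -mulr_natl mulf_eq0 pnatr_eq0 => /eqP.
Qed.

(** If all higher coefficients vanish, then on the radius 1/(2K) the distance of [f] from [s 0] is
    below B/2^n for every n. Otherwise the first nonzero one gives the leading behaviour. *)
Lemma germ_dichotomy f a s : germ f a s ->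
  (exists2 r : R, 0 < r & forall z, z != 0 -> cabs z <= r -> f (a + z) = s 0%N) \/
  (exists k (B r : R), [/\ s k.+1 != 0, 0 <= B, 0 < r &
     forall z, z != 0 -> cabs z <= r ->
       cabs (f (a + z) - s 0%N - s k.+1 * z ^+ k.+1) <= B * cabs z ^+ k.+2]).
Proof.
move=> [B [K h]]; have B0 := germ_bound_ge0 h; have [K0 {}h] := h.
have trE m z : (forall k, (k < m)%N -> s k.+1 = 0) -> taylor s m.+1 z = s 0%N.
  move=> sm; rewrite /taylor big_ord_recl expr0 mulr1 big1 ?addr0 // => k _.
  by rewrite sm ?mul0r //; exact: ltn_ord.
have [s0|] := pselect (forall k, s k.+1 = 0).
  left; exists (2 * K)^-1; first by rewrite invr_gt0 mulr_gt0.
  move=> z z0 hz; have cz : 0 < cabs z by rewrite cabs_gt0.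
  have x2 : K * cabs z <= 2^-1.
    by move: hz; rewrite -[leRHS]div1r ler_pdivlMr ?mulr_gt0 //; lra.
  apply/eqP; rewrite -subr_eq0 -cabs_eq0 eq_le cabs_ge0 andbT.
  apply/ler_addgt0Pr => e e0; rewrite add0r.
  have [n hn] : exists n : nat, B / e < n%:R.
    by exists (Num.bound (B / e)); apply: archi_boundP; rewrite divr_ge0 // ltW.
  have := h n.+1 z z0; rewrite trE // => /(_ _)/le_trans; apply; first by lra.
  have h1 : (K * cabs z) ^+ n.+1 <= (2^-1) ^+ n.+1.
    by rewrite lerXn2r ?nnegrE //; rewrite mulr_ge0 ?cabs_ge0 // ltW.
  apply: le_trans (ler_wpM2l B0 h1) _.
  rewrite exprVn ler_pdivrMr ?exprn_gt0 //.
  move: hn; rewrite ltr_pdivrMr // => /ltW/le_trans; apply; rewrite mulrC.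
  by rewrite ler_pM2l // -natrX ler_nat ltnW // (leq_trans (ltnSn n)) // ltnW // ltn_expl.
move=> /existsNP ex; right.
have ex' : exists k, s k.+1 != 0 by move: ex => [k /eqP hk]; exists k.
case: (ex_minnP ex') => k sk kmin.
have sm j : (j < k)%N -> s j.+1 = 0.
  by move=> jk; apply/eqP; apply: contraLR jk => /kmin; rewrite -leqNgt.
exists k, (B * K ^+ k.+2), K^-1; split; rewrite ?invr_gt0 //.
  by rewrite mulr_ge0 // exprn_ge0 // ltW.
move=> z z0 hz; have := h k.+2 z z0; rewrite taylorS trE // opprD addrA.
rewrite exprMn mulrA; apply; rewrite mulrC -ler_pdivlMr // div1r //.
Qed.

Lemma germ_isolated f a s : germ f a s ->
  (exists2 r : R, 0 < r & forall z, z != 0 -> cabs z <= r -> f (a + z) = s 0%N) \/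
  (exists2 r : R, 0 < r & forall z, z != 0 -> cabs z <= r -> f (a + z) <> s 0%N).
Proof.
move=> /germ_dichotomy[|[k [B [r [sk B0 r0 h]]]]]; [by left|right].
have c0 : 0 < cabs (s k.+1) by rewrite cabs_gt0.
have D0 : 0 < B + 1 by lra.
exists (Num.min r (cabs (s k.+1) / 2 / (B + 1))).
  by rewrite lt_min r0 !divr_gt0.
move=> z z0; rewrite le_min => /andP[zr zs] fz.
have cz : 0 < cabs z by rewrite cabs_gt0.
have := h z z0 zr; rewrite fz subrr sub0r cabsN cabsM cabsX exprS (exprSr (cabs z) k.+1).
have := exprn_gt0 k.+1 cz; rewrite -exprS; set X := _ ^+ k.+1 => X0.
rewrite mulrA -mulrA mulrCA -[X in X <= _]mulrC ler_pM2l //.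
move: zs; rewrite ler_pdivlMr //; nra.
Qed.

(* If f = s_0 + s_k z^k + O(z^(k+1)), moving z along a k-th root of s_0 / s_k
   increases the modulus. *)
Lemma germ_maxmod f a s (r : R) : germ f a s -> 0 < r ->
  (forall z, z != 0 -> cabs z <= r -> cabs (f (a + z)) <= cabs (s 0%N)) ->
  exists2 r' : R, 0 < r' & forall z, z != 0 -> cabs z <= r' -> f (a + z) = s 0%N.
Proof.
move=> hg r0 hmax.
have [s0|s0] := eqVneq (s 0%N) 0.
  exists r => // z z0 zr; have := hmax z z0 zr; rewrite s0 cabs0 => h.
  by apply/eqP; rewrite -cabs_eq0 eq_le h cabs_ge0.
case: (germ_dichotomy hg) => // -[k [B [q [sk B0 q0 h]]]].
pose w := k.+1.-root (s 0%N / s k.+1).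
have wk : w ^+ k.+1 = s 0%N / s k.+1 by rewrite rootCK.
have w0 : w != 0.
  by apply/eqP => w0; move: wk; rewrite w0 expr0n /= => /esym/eqP;
     rewrite mulf_eq0 invr_eq0 (negbTE s0) (negbTE sk).
pose W := cabs w; have W0 : 0 < W by rewrite cabs_gt0.
have S0 : 0 < cabs (s 0%N) by rewrite cabs_gt0.
have D0 : 0 < B * W ^+ k.+2 + 1 by rewrite ltr_wpDl // mulr_ge0 // exprn_ge0 // ltW.
(* The first bound keeps z = tau w within both radii. The second makes the error B |z|^(k+2) at most
   half of the gain tau^(k+1) |s_0|. *)
pose tau := Num.min (Num.min r q / W) (cabs (s 0%N) / 2 / (B * W ^+ k.+2 + 1)).
have tau0 : 0 < tau by rewrite lt_min !divr_gt0 // lt_min r0.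
have tau1 : tau * W <= Num.min r q.
  by rewrite -ler_pdivlMr // ge_min lexx.
have tau2 : tau * (B * W ^+ k.+2 + 1) <= cabs (s 0%N) / 2.
  by rewrite -ler_pdivlMr // ge_min lexx orbT.
pose z : C := tau%:C%C * w.
have az : cabs z = tau * W by rewrite cabsM cabs_real gtr0_norm.
have z0 : z != 0 by rewrite -cabs_gt0 az mulr_gt0.
move: tau1; rewrite -az le_min => /andP[zr zq].
have := hmax z z0 zr; have := h z z0 zq.
rewrite {3}/z exprMn wk -rmorphXn /=.
have -> : f (a + z) - s 0%N - s k.+1 * ((tau ^+ k.+1)%:C%C * (s 0%N / s k.+1)) =
  f (a + z) - (1 + tau ^+ k.+1)%:C%C * s 0%N.
  by rewrite rmorphD rmorph1 /=; field.
rewrite cabsC => h1 h2.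
have := cabsBr ((1 + tau ^+ k.+1)%:C%C * s 0%N) (- f (a + z)); rewrite cabsN.
have tk := exprn_gt0 k.+1 tau0.
rewrite cabsM cabs_real gtr0_norm; last lra.
move: h1; rewrite az exprMn (exprS tau k.+1); move: tau2 tk.
set Wk := W ^+ _; set tk := tau ^+ k.+1 => tau2 tk0 h1 h3.
have : tk * (tau * (B * Wk + 1)) <= tk * (cabs (s 0%N) / 2) by rewrite ler_pM2l.
have := mulr_gt0 tk0 tau0; have := mulr_gt0 tk0 S0; exfalso; nra.
Qed.

End Germs.

(** * Connectedness of the plane and termwise summation of germs *)

Section Families.
Variable R : realType.
Local Notation C := (R[i]).
Implicit Types (a z u v : C) (f g : C -> C).

(** Connectedness along the segment from [u0] to [u]: the supremum of the parameters up to which [P]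
    holds is attained because [P] is closed, and cannot lie below 1 because [P] is open. *)
Lemma clopen_all (P : C -> Prop) (u0 : C) : P u0 ->
  (forall u, P u -> exists2 r : R, 0 < r & forall z, cabs z <= r -> P (u + z)) ->
  (forall u, (forall e : R, 0 < e -> exists2 z, cabs z <= e & P (u + z)) -> P u) ->
  forall u, P u.
Proof.
move=> P0 Po Pc u; pose d := u - u0; pose g (t : R) : C := u0 + t%:C%C * d.
have gD (t e : R) : g (t + e) = g t + e%:C%C * d by rewrite /g rmorphD /=; ring.
have cgD (e : R) : cabs (e%:C%C * d) = `|e| * cabs d by rewrite cabsM cabs_real.
pose S := [set t : R | 0 <= t <= 1 /\ forall x, 0 <= x <= t -> P (g x)].
have S0 : S 0.
  split=> [|x hx]; first by rewrite lexx ler01.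
  have -> : x = 0 by lra.
  by rewrite /g mul0r addr0.
have hS : has_sup S by split; [exists 0 | exists 1 => t [/andP[]]].
have T0 : 0 <= sup S by apply: ub_le_sup => //; exact: hS.2.
have T1 : sup S <= 1 by apply: ge_sup; [exists 0|move=> t [/andP[]]].
have below x : 0 <= x -> x < sup S -> P (g x).
  move=> x0 xS; have e0 : 0 < sup S - x by lra.
  have [t [_ ht] hxt] := sup_adherent e0 hS; apply: ht; lra.
have D0 : 0 < cabs d + 1 by rewrite ltr_wpDl ?cabs_ge0.
have PT : P (g (sup S)).
  have [e|Sn0] := eqVneq (sup S) 0; first by rewrite e /g mul0r addr0.
  apply: Pc => e e0; pose h := Num.min (sup S) (e / (cabs d + 1)).
  have h0 : 0 < h by rewrite lt_min divr_gt0 // andbT lt_neqAle eq_sym Sn0.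
  have h1 : h <= sup S by rewrite ge_min lexx.
  have h2 : h * (cabs d + 1) <= e by rewrite -ler_pdivlMr // ge_min lexx orbT.
  exists ((- h)%:C%C * d); first by rewrite cgD normrN gtr0_norm //; lra.
  by rewrite -gD; apply: below; lra.
have [r r0 hr] := Po _ PT.
have near x : `|x - sup S| * (cabs d + 1) <= r -> P (g x).
  move=> hx; rewrite -(subrK (sup S) x) addrC gD; apply: hr; rewrite cgD.
  by have := normr_ge0 (x - sup S); lra.
have [S1|S1] := eqVneq (sup S) 1.
  by move: PT; rewrite S1 /g mul1r /d addrC subrK.
exfalso; pose h := Num.min (1 - sup S) (r / (cabs d + 1)).
have S1' : 0 < 1 - sup S by rewrite subr_gt0 lt_neqAle S1.
have h0 : 0 < h by rewrite lt_min divr_gt0 // andbT.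
have h1 : h <= 1 - sup S by rewrite ge_min lexx.
have h2 : h * (cabs d + 1) <= r by rewrite -ler_pdivlMr // ge_min lexx orbT.
have : S (sup S + h).
  split=> [|x hx]; first lra.
  have [xS|xS] := ltP x (sup S); first by apply: below => //; lra.
  apply: near; rewrite ger0_norm; last lra.
  apply: le_trans h2; rewrite ler_pM2r //; lra.
move=> /(ub_le_sup hS.2); lra.
Qed.

Lemma has_sum1 a (c : C) : has_sum (fun v => if v == a then c else 0) c.
Proof.
move=> e e0; exists [fset a]%fset => B; rewrite fsub1set => aB.
rewrite (big_fsetD1 a) //= eqxx big_seq big1 ?addr0 ?subrr ?cabs0 // => v.
by rewrite !inE => /andP[/negbTE ->].
Qed.

(** Weierstrass's theorem on series of analytic functions. A common [K] and summable constants [m v]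
    make the coefficients summable and let the remainder bounds be added. *)
Lemma germ_has_sum (t : C -> C -> C) (s : C -> nat -> C) (m : C -> R) a (K M : R) F :
  (forall v, germ_bound (t v) a (s v) (m v) K) ->
  (forall B : {fset C}, \sum_(v <- B) m v <= M) ->
  (forall z, z != 0 -> K * cabs z <= 1 -> has_sum (fun v => t v (a + z)) (F (a + z))) ->
  exists2 S, germ F a S & forall k, has_sum (fun v => s v k) (S k).
Proof.
move=> ht hM hF; have K0 : 0 < K by have [] := ht 0.
have : forall k, exists x, has_sum (fun v => s v k) x.
  move=> k; apply: (@has_sum_dom _ _ (2 * M * K ^+ k)) => B.
  rewrite (@le_trans _ _ (\sum_(v <- B) 2 * m v * K ^+ k)) //.
    by apply: ler_sum => v _; exact: germ_coef.
  rewrite -mulr_suml -mulr_sumr ler_wpM2r ?exprn_ge0 ?(ltW K0) //.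
  by rewrite ler_wpM2l.
move=> /choice[S hS]; exists S => //; exists M, K; split=> // n z z0 hz.
have hT : has_sum (fun v => taylor (s v) n z) (taylor S n z).
  apply: (@has_sum_big _ _ _ (fun (k : 'I_n) v => s v k * z ^+ k)) => k.
  by rewrite mulrC; apply: eq_has_sum (has_sumZ _ (hS k)) => v; rewrite mulrC.
apply: has_sum_bound (has_sumB (hF z z0 hz) hT) => B.
apply: le_trans (_ : \sum_(v <- B) m v * (K * cabs z) ^+ n <= _).
  by apply: ler_sum => v _; have [_] := ht v; apply.
by rewrite -mulr_suml ler_wpM2r // exprn_ge0 // mulr_ge0 ?cabs_ge0 // ltW.
Qed.

End Families.

(** * Discrete subgroups of the plane *)

Section DiscreteGroups.
Variable R : realType.
Local Notation C := (R[i]).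
Implicit Types (M : set C) (a z u v : C).

(** In a subgroup the difference of two points is again a point, so a gap around 0 separates all
    points by [e]. *)
Definition udiscrete M (e : R) : Prop :=
  0 < e /\ forall v, M v -> v != 0 -> e <= cabs v.

Lemma subgroupN M v : subgroup M -> M v -> M (- v).
Proof. by move=> [M0 MB] Mv; rewrite -sub0r; exact: MB. Qed.

Lemma subgroupD M u v : subgroup M -> M u -> M v -> M (u + v).
Proof. by move=> sM Mu Mv; rewrite -(opprK v); apply: sM.2 => //; exact: subgroupN. Qed.

Lemma subgroupNE M v : subgroup M -> (- v \in M) = (v \in M).
Proof.
move=> sM; apply/idP/idP; rewrite !in_setE; last exact: subgroupN.
by move=> /(subgroupN sM); rewrite opprK.
Qed.

Lemma subgroupBE M w v : subgroup M -> M w -> (v - w \in M) = (v \in M).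
Proof.
move=> sM Mw; apply/idP/idP; rewrite !in_setE => h; last exact: sM.2.
by rewrite -(subrK w v); exact: subgroupD.
Qed.

(** Weights of order n^(-3/2) whose partial sums telescope. On the cell (k, l) the product of two of
    them dominates a multiple of |v|^-3, because (k + 2)(l + 2) is at most a multiple of |v|^2. *)
Definition telw (n : nat) : R := (Num.sqrt n.+1%:R)^-1 - (Num.sqrt n.+2%:R)^-1.

Lemma sqrtn_gt0 n : 0 < Num.sqrt n.+1%:R :> R.
Proof. by rewrite sqrtr_gt0. Qed.

Lemma telw_lb n : (2 * Num.sqrt n.+2%:R ^+ 3)^-1 <= telw n.
Proof.
rewrite /telw; have x0 := sqrtn_gt0 n; have y0 := sqrtn_gt0 n.+1.
have xx : Num.sqrt n.+1%:R ^+ 2 = n.+1%:R :> R by rewrite sqr_sqrtr.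
have yy : Num.sqrt n.+2%:R ^+ 2 = n.+2%:R :> R by rewrite sqr_sqrtr.
have xy : Num.sqrt n.+1%:R <= Num.sqrt n.+2%:R :> R by rewrite ler_wsqrtr // ler_nat.
have yx : Num.sqrt n.+2%:R ^+ 2 = Num.sqrt n.+1%:R ^+ 2 + 1 :> R.
  by rewrite xx yy -natr1.
move: x0 y0 xy yx; set x := Num.sqrt n.+1%:R; set y := Num.sqrt _ => x0 y0 xy yx.
have -> : x^-1 - y^-1 = (x * y * (x + y))^-1.
  have d : (y - x) * (x + y) = 1 by lra.
  have xn : x != 0 by rewrite gt_eqF.
  have yn : y != 0 by rewrite gt_eqF.
  have sn : x + y != 0 by rewrite gt_eqF ?addr_gt0.
  rewrite -[RHS]mul1r -{1}d; field; by rewrite xn yn sn.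
rewrite lef_pV2 ?posrE ?mulr_gt0 ?exprn_gt0 ?addr_gt0 //.
have : x * y <= y * y by rewrite ler_pM2r.
have := mulr_gt0 y0 y0; rewrite !exprS expr0; nra.
Qed.

Lemma telw_ge0 n : 0 <= telw n.
Proof.
by apply: le_trans (telw_lb n); rewrite invr_ge0 mulr_ge0 // exprn_ge0 // sqrtr_ge0.
Qed.

Lemma sum_telw n : \sum_(i < n) telw i <= 1.
Proof.
have -> : \sum_(i < n) telw i = 1 - (Num.sqrt n.+1%:R)^-1.
  elim: n => [|n IH]; first by rewrite big_ord0 sqrtr1 invr1 subrr.
  by rewrite big_ord_recr /= IH /telw; ring.
by rewrite gerBl invr_ge0 sqrtr_ge0.
Qed.

(** The terms of the Weierstrass series decay like |v|^-3. The value 1 at 0 lets the term with v = 0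
    be bounded by the same family. *)
Definition majorant M v : R :=
  if v \in M then (if v == 0 then 1 else cabs v ^- 3) else 0.

Lemma majorant_ge0 M v : 0 <= majorant M v.
Proof.
by rewrite /majorant; case: ifP => // _; case: ifP => // _; rewrite invr_ge0 exprn_ge0 ?cabs_ge0.
Qed.

Definition cell (d x : R) : nat := Num.trunc (`|x| / d).

(** The index [cell] truncates |x|/d and forgets the sign, which must therefore be compared
    separately. *)
Lemma cell_inj d x y : 0 < d -> cell d x = cell d y -> (x < 0) = (y < 0) -> `|x - y| < d.
Proof.
move=> d0 hc hs.
have n0 (w : R) : 0 <= `|w| / d by rewrite divr_ge0 // ltW.
have /andP[x1 x2] := truncn_itv (n0 x); have /andP[y1 y2] := truncn_itv (n0 y).
move: x1 x2 y1 y2; rewrite -/(cell d x) -/(cell d y) hc.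
rewrite !ler_pdivlMr // !ltr_pdivrMr // -natr1 => x1 x2 y1 y2.
rewrite ltr_norml; move: hs x1 x2 y1 y2.
have [x0|x0] := ltP x 0; have [y0|y0] := ltP y 0 => // _.
  by rewrite !ltr0_norm // => *; apply/andP; split; lra.
by rewrite !ger0_norm // => *; apply/andP; split; lra.
Qed.

(* Points of M are separated by the cells of a square grid of side d, so the
   cubic sum is dominated by a sum of products of telescoping weights over the
   grid. *)
Lemma sum_majorant M e : subgroup M -> udiscrete M e ->
  exists D : R, forall B : {fset C}, \sum_(v <- B) majorant M v <= D.
Proof.
(* Two points of one cell with equal signs differ by less than e/2 in each coordinate, hence by less
   than [e]. *)
move=> sM [e0 he]; pose d := e / 2; have d0 : 0 < d by rewrite divr_gt0.
pose k (v : C) := cell d (complex.Re v); pose l (v : C) := cell d (complex.Im v).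
pose C0 := d^-1 + 2 / e.
have C00 : 0 < C0 by rewrite addr_gt0 ?invr_gt0 ?divr_gt0.
(* For v != 0 the product of the lower bounds [telw_lb] has denominator 4 ((k + 2)(l + 2))^(3/2), at
   most 4 (C0 |v|)^3. At v = 0 this denominator is 4 * 2^3 = 32. *)
pose E := 4 * C0 ^+ 3 + 32.
have E0 : 0 <= E by rewrite addr_ge0 // mulr_ge0 // exprn_ge0 // ltW.
have mjE v : majorant M v <= E * (telw (k v) * telw (l v)).
  rewrite /majorant; case: ifPn => vM; last by rewrite !mulr_ge0 ?telw_ge0.
  apply: le_trans (_ : E * ((2 * Num.sqrt (k v).+2%:R ^+ 3)^-1 * (2 * Num.sqrt (l v).+2%:R ^+ 3)^-1) <= _); last first.
    by rewrite ler_wpM2l // ler_pM ?telw_lb // invr_ge0 mulr_ge0 // exprn_ge0 // sqrtr_ge0.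
  case: eqP => [->|/eqP v0].
    rewrite /k /l /cell /= normr0 mul0r truncn0.
    have s2 : Num.sqrt 2%:R ^+ 2 = 2%:R :> R by rewrite sqr_sqrtr.
    have -> : E * ((2 * Num.sqrt 2%:R ^+ 3)^-1 * (2 * Num.sqrt 2%:R ^+ 3)^-1) = E / 32.
      rewrite -invfM; congr (_ / _).
      have -> : 2 * Num.sqrt 2%:R ^+ 3 * (2 * Num.sqrt 2%:R ^+ 3) = 4 * (Num.sqrt 2%:R ^+ 2) ^+ 3 :> R by ring.
      by rewrite s2; ring.
    by rewrite ler_pdivlMr // mul1r /E lerDr mulr_ge0 // exprn_ge0 // ltW.
  have ev : e <= cabs v by apply: he => //; rewrite in_setE in vM.
  have cv : 0 < cabs v by apply: lt_le_trans ev.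
  have b x : `|x| <= cabs v -> (cell d x).+2%:R <= C0 * cabs v.
    move=> hx; have x0 : 0 <= `|x| / d by rewrite divr_ge0 // ltW.
    have /andP[x1 _] := truncn_itv x0; move: x1; rewrite -/(cell d x) => x1.
    have h1 : (cell d x)%:R <= d^-1 * cabs v.
      by rewrite (le_trans x1) // mulrC ler_pM2l ?invr_gt0.
    have h2 : 2 <= 2 / e * cabs v by rewrite mulrAC ler_pdivlMr // ler_pM2l.
    by rewrite -addn2 natrD mulrDl; lra.
  have ck := b _ (cabs_Re v); have cl := b _ (cabs_Im v).
  set y := Num.sqrt (k v).+2%:R; set y' := Num.sqrt (l v).+2%:R.
  have y0 : 0 < y by rewrite sqrtn_gt0.
  have y0' : 0 < y' by rewrite sqrtn_gt0.
  have yy : y * y' <= C0 * cabs v.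
    have h1 : 0 <= y * y' by rewrite mulr_ge0 // ltW.
    have h2 : 0 <= C0 * cabs v by rewrite mulr_ge0 // ltW.
    rewrite -(ler_pXn2r (n := 2)) ?nnegrE //.
    by rewrite [leLHS]exprMn !sqr_sqrtr ?ler0n // [leRHS]expr2 ler_pM.
  have y3 : (y * y') ^+ 3 <= (C0 * cabs v) ^+ 3.
    by rewrite lerXn2r // nnegrE mulr_ge0 ?cabs_ge0 // ltW.
  rewrite -invfM.
  have -> : 2 * y ^+ 3 * (2 * y' ^+ 3) = 4 * (y * y') ^+ 3 by ring.
  rewrite ler_pdivlMr ?mulr_gt0 ?exprn_gt0 ?mulr_gt0 //.
  rewrite mulrC ler_pdivrMr ?exprn_gt0 //.
  have := exprn_gt0 3 cv; move: y3; rewrite exprMn /E; nra.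
have klinj u v : M u -> M v -> k u = k v -> l u = l v ->
    (complex.Re u < 0) = (complex.Re v < 0) -> (complex.Im u < 0) = (complex.Im v < 0) -> u = v.
  move=> Mu Mv h1 h2 h3 h4; apply/eqP; rewrite -subr_eq0; apply/negPn/negP => uv.
  have := he _ (sM.2 _ _ Mu Mv) uv; have := cabs_le_ReIm (u - v).
  have := cell_inj d0 h1 h3; have := cell_inj d0 h2 h4.
  rewrite !raddfB /= /d; lra.
(* Each coordinate contributes at most 2: the telescoping sum is at most 1 for either sign. *)
exists (E * 4) => B.
pose N := (\max_(v <- B) maxn (k v) (l v)).
pose T := (('I_N.+1 * bool) * ('I_N.+1 * bool))%type.
pose phi (v : C) : T := ((inord (k v), complex.Re v < 0), (inord (l v), complex.Im v < 0)).
pose G (t : T) := telw t.1.1 * telw t.2.1.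
have G0 t : 0 <= G t by rewrite mulr_ge0 ?telw_ge0.
have kN v : v \in B -> (k v < N.+1)%N /\ (l v < N.+1)%N.
  move=> vB; have : (maxn (k v) (l v) <= N)%N by exact: leq_bigmax_seq.
  by rewrite geq_max !ltnS => /andP[].
pose r := [seq v <- B | v \in M].
have -> : \sum_(v <- B) majorant M v = \sum_(v <- r) majorant M v.
  rewrite big_filter [RHS]big_mkcond; apply: eq_bigr => v _.
  by rewrite /majorant; case: ifP.
have hr v : v \in r -> v \in B /\ M v.
  by rewrite mem_filter => /andP[]; rewrite in_setE.
apply: le_trans (_ : \sum_(v <- r) E * G (phi v) <= _).
  rewrite big_seq [leRHS]big_seq; apply: ler_sum => v /hr[/kN[kv lv] _].
  by rewrite /G /= !inordK.
rewrite -mulr_sumr ler_wpM2l // -(big_map phi xpredT G).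
have ur : uniq (map phi r).
  rewrite map_inj_in_uniq ?filter_uniq ?fset_uniq // => u v /hr[uB Mu] /hr[vB Mv] [h1 h2 h3 h4].
  apply: klinj => //; [move: h1 => /(congr1 val)|move: h3 => /(congr1 val)].
    by rewrite /= !inordK //; [exact: (kN _ vB).1|exact: (kN _ uB).1].
  by rewrite /= !inordK //; [exact: (kN _ vB).2|exact: (kN _ uB).2].
rewrite big_uniq //=.
apply: le_trans (_ : \sum_(t : T) G t <= _).
  by rewrite [leRHS](bigID (mem (map phi r))) /= lerDl sumr_ge0.
have s1 : \sum_(p : 'I_N.+1 * bool) telw p.1 <= 2.
  rewrite -(pair_bigA _ (fun (i : 'I_N.+1) (_ : bool) => telw i)) /=.
  under eq_bigr do rewrite big_bool.
  by rewrite big_split /=; have := sum_telw N.+1; lra.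
have s0 : 0 <= \sum_(p : 'I_N.+1 * bool) telw p.1.
  by apply: sumr_ge0 => p _; exact: telw_ge0.
rewrite -(pair_bigA _ (fun p q : 'I_N.+1 * bool => telw p.1 * telw q.1)) /=.
under eq_bigr do rewrite -mulr_sumr.
by rewrite -mulr_suml (le_trans (ler_pM s0 s0 s1 s1)) //; lra.
Qed.

End DiscreteGroups.

(** * The Weierstrass function *)

Section Weierstrass.
Variable R : realType.
Local Notation C := (R[i]).
Implicit Types (M : set C) (a b z u v w : C).

(** The expansion of (z - b)^-2 is the derived geometric series; its remainder has a closed form,
    valid for every z != b. *)
Lemma inv_sqr_expansion b z n : b != 0 -> z != b ->
  (z - b) ^- 2 - taylor (fun k => k.+1%:R / b ^+ k.+2) n z =
  z ^+ n * (n.+1%:R * b - n%:R * z) / (b ^+ n.+1 * (z - b) ^+ 2).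
Proof.
move=> b0 zb; have zb0 : z - b != 0 by rewrite subr_eq0.
elim: n => [|n IH].
  by rewrite taylor0 subr0 expr0 mul0r subr0 !mul1r expr1; field; rewrite b0 zb0.
rewrite taylorS opprD addrA IH !exprS -!natr1.
have bn : b ^+ n != 0 by rewrite expf_neq0.
by field; rewrite b0 bn zb0.
Qed.

(** Here |z| <= |b|/2, so |z - b|^-2 <= 4 |b|^-2, and the linear factor costs 3 * 2^(n+1): hence 12.
    Of the n + 1 factors 1/|b| only n are weakened to 1/d; the last one is kept to reach the
    summable order |b|^-3. *)
Lemma inv_sqr_remainder b z n (d : R) : 0 < d -> d <= cabs b -> 2 / d * cabs z <= 1 ->
  cabs ((z - b) ^- 2 - taylor (fun k => k.+1%:R / b ^+ k.+2) n.+1 z) <=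
  12 * d * cabs b ^- 3 * (2 / d * cabs z) ^+ n.+1.
Proof.
move=> d0 db hz; have cb : 0 < cabs b by apply: lt_le_trans db.
have b0 : b != 0 by rewrite -cabs_gt0.
have z2 : 2 * cabs z <= cabs b.
  apply: le_trans db; move: hz; rewrite mulrAC ler_pdivrMr // mul1r; lra.
have zb2 : cabs b <= 2 * cabs (z - b).
  by have := cabsBr b (- z); rewrite cabsN -(cabsC z); lra.
have zb : z != b by rewrite -subr_eq0 -cabs_gt0; lra.
rewrite inv_sqr_expansion // !cabsM cabsV cabsM !cabsX.
set x := cabs z; set y := cabs b; set t := cabs (z - b).
have t0 : 0 < t by move: zb2; rewrite -/y -/t; move: cb; rewrite -/y; lra.
have x0 : 0 <= x by exact: cabs_ge0.
have h1 : cabs (n.+2%:R * b - n.+1%:R * z) <= 3 * 2 ^+ n.+1 * y.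
  rewrite (le_trans (cabsB _ _)) // !cabsM !cabs_nat -/x -/y.
  have e3 : n.+2%:R <= 2 ^+ n.+1 :> R by rewrite -natrX ler_nat ltn_expl.
  have e1 : n.+1%:R <= n.+2%:R :> R by rewrite ler_nat.
  have e0 : 0 <= n.+1%:R :> R by [].
  move: e3 e1 e0 z2 cb x0; rewrite -/x -/y; nra.
have P0 : 0 < y ^+ n.+2 * t ^+ 2 by apply: mulr_gt0; apply: exprn_gt0.
rewrite ler_pdivrMr //.
apply: le_trans (ler_wpM2l (exprn_ge0 _ x0) h1) _.
have -> : 12 * d * y ^- 3 * (2 / d * x) ^+ n.+1 * (y ^+ n.+2 * t ^+ 2) =
   x ^+ n.+1 * (3 * 2 ^+ n.+1) * ((2 * t) ^+ 2 * (y ^+ n / d ^+ n) / y).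
  have yn : y != 0 by rewrite gt_eqF.
  have dn : d != 0 by rewrite gt_eqF.
  rewrite !exprMn exprVn (exprS d) (exprS y n.+1) (exprS y n).
  by field; rewrite yn expf_neq0 // dn.
rewrite -(mulrA (x ^+ n.+1) (3 * 2 ^+ n.+1)) ler_wpM2l ?exprn_ge0 // ler_wpM2l //.
rewrite ler_pdivlMr // -[leLHS]mulr1.
apply: ler_pM; rewrite ?ler01 //; first by rewrite mulr_ge0 // ltW.
  by rewrite -expr2 lerXn2r // nnegrE ?mulr_ge0 // ltW.
by rewrite ler_pdivlMr ?exprn_gt0 // mul1r lerXn2r // nnegrE ltW.
Qed.

(** Since 0^-1 = 0, the term with v = 0 is u^-2. The leading term of wp thus belongs to the family,
    and the sum runs over the whole group, where translations can reindex it. *)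
Definition wterm M u v : C := if v \in M then (u - v) ^- 2 - v ^- 2 else 0.

(* The terms without the one that is singular at u = a. *)
Definition wterm' M a u v : C := if v == a then 0 else wterm M u v.

(* At points of M the singular term has the junk value 0^-1 = 0; this makes wpf
   periodic without exception. *)
Definition wpf M u : C := summability.sum (wterm M u : C -> C^o).

(** At most one point of [M] lies closer than e/2 to [a]; its distance, or else e/2, is the
    bound. *)
Lemma dist_to_group M e a : subgroup M -> udiscrete M e ->
  exists2 d : R, 0 < d & forall v, M v -> v != a -> d <= cabs (v - a).
Proof.
move=> sM [e0 he]; have [[v0 [Mv0 v0a hv0]]|hn] :=
  pselect (exists v0, [/\ M v0, v0 != a & cabs (v0 - a) < e / 2]).
  exists (cabs (v0 - a)); first by rewrite cabs_gt0 subr_eq0.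
  move=> v Mv va; have [->//|vv] := eqVneq v v0.
  have := he _ (sM.2 _ _ Mv Mv0); rewrite subr_eq0 => /(_ vv).
  have := cabsB (v - a) (v0 - a); rewrite (_ : v - a - (v0 - a) = v - v0); last by ring.
  lra.
exists (e / 2); first by rewrite divr_gt0.
by move=> v Mv va; rewrite leNgt; apply/negP => h; apply: hn; exists v.
Qed.

(** The poles of the remaining terms are at distance at least [d] from [a], which gives the common K
    = 2/d. The correction v^-2 raises the decay from order two to order three. *)
Lemma wterm_germ M e a : subgroup M -> udiscrete M e ->
  exists K G : R, [/\ 0 < K, 0 <= G,
    forall v, exists2 s, germ_bound (fun u => wterm' M a u v) a s (G * majorant M v) K &
                         s 0%N = wterm' M a a v &
    forall v, cabs (wterm' M a a v) <= G * majorant M v].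
Proof.
move=> sM ue; have [d d0 hd] := dist_to_group a sM ue.
(* Chosen so that ka |v| <= |v - a|: the factor 1/2 serves for |v| >= 2 |a|, the other one for
   smaller v, where |v - a| >= d. *)
pose ka := Num.min 2^-1 (d / (2 * cabs a + 1)).
have A0 : 0 <= cabs a by exact: cabs_ge0.
have D0 : 0 < 2 * cabs a + 1 by lra.
have k0 : 0 < ka by rewrite lt_min invr_gt0 divr_gt0 // andbT.
have k1 : ka <= 2^-1 by rewrite ge_min lexx.
have k2 : ka * (2 * cabs a + 1) <= d by rewrite -ler_pdivlMr // ge_min lexx orbT.
have hk v : M v -> v != a -> ka * cabs v <= cabs (v - a).
  move=> Mv va; have := hd v Mv va; have := cabsBr v (- a); rewrite cabsN.
  have := cabs_ge0 v; have [h|h] := leP (2 * cabs a) (cabs v); nra.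
pose g3 := ka ^- 3 + d ^- 3.
have g30 : 0 <= g3 by rewrite addr_ge0 // invr_ge0 exprn_ge0 // ltW.
have h3 v : M v -> v != a -> cabs (v - a) ^- 3 <= g3 * majorant M v.
  move=> Mv va; have va0 : 0 < cabs (v - a) by apply: lt_le_trans (hd v Mv va).
  rewrite /majorant mem_set //; case: eqP => [v0|/eqP v0].
    rewrite mulr1 (@le_trans _ _ (d ^- 3)) //.
      by rewrite lef_pV2 ?posrE ?exprn_gt0 // lerXn2r ?nnegrE ?cabs_ge0 ?hd // ltW.
    by rewrite lerDr invr_ge0 exprn_ge0 // ltW.
  have cv : 0 < cabs v by rewrite cabs_gt0.
  rewrite (@le_trans _ _ ((ka * cabs v) ^- 3)) //.
    rewrite lef_pV2 ?posrE ?exprn_gt0 ?mulr_gt0 // lerXn2r ?nnegrE ?cabs_ge0 ?hk //.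
    by rewrite mulr_ge0 // ltW.
  rewrite exprMn invfM mulrDl lerDl mulr_ge0 // invr_ge0 exprn_ge0 // ltW //.
(* The two summands in the bracket come from the two fractions into which (a - v)^-2 - v^-2 is split
   below; |a|^-2 accounts for v = 0. *)
pose g2 := cabs a * (ka ^- 2 + ka ^- 1) + cabs a ^- 2.
have g20 : 0 <= g2.
  rewrite addr_ge0 ?mulr_ge0 ?addr_ge0 ?invr_ge0 ?exprn_ge0 //; exact: ltW.
have h2 v : cabs (wterm' M a a v) <= g2 * majorant M v.
  rewrite /wterm' /wterm; case: eqP => [_|/eqP va]; first by rewrite cabs0 mulr_ge0 // majorant_ge0.
  case: ifPn => vM; last by rewrite cabs0 mulr_ge0 // majorant_ge0.
  rewrite /majorant vM; move: vM; rewrite in_setE => Mv.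
  case: eqP => [->|/eqP v0].
    rewrite expr0n invr0 !subr0 mulr1 cabsV cabsX lerDr mulr_ge0 // addr_ge0 // invr_ge0 ?exprn_ge0 // ltW //.
  have cv : 0 < cabs v by rewrite cabs_gt0.
  have cva : 0 < cabs (v - a) by apply: lt_le_trans (hd v Mv va).
  have va0 : v - a != 0 by rewrite subr_eq0.
  have kv := hk v Mv va.
  have kv0 : 0 < ka * cabs v by rewrite mulr_gt0.
  have -> : (a - v) ^- 2 - v ^- 2 = a / (v * (v - a) ^+ 2) + a / (v ^+ 2 * (v - a)).
    by field; rewrite v0 va0 -oppr_eq0 opprB va0.
  apply: le_trans (cabsD _ _) _.
  rewrite !(cabsM a) !cabsV (cabsM v) (cabsM (v ^+ 2)) !cabsX.
  have kn : ka != 0 by rewrite gt_eqF.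
  have vn : cabs v != 0 by rewrite gt_eqF.
  have e1 : (cabs v * cabs (v - a) ^+ 2)^-1 <= ka ^- 2 * cabs v ^- 3.
    have -> : ka ^- 2 * cabs v ^- 3 = (cabs v * (ka * cabs v) ^+ 2)^-1.
      by field; rewrite kn vn.
    rewrite lef_pV2 ?posrE ?(mulr_gt0 cv (exprn_gt0 2 _)) // ler_pM2l //.
    by rewrite lerXn2r // nnegrE ltW.
  have e2 : (cabs v ^+ 2 * cabs (v - a))^-1 <= ka^-1 * cabs v ^- 3.
    have -> : ka^-1 * cabs v ^- 3 = (cabs v ^+ 2 * (ka * cabs v))^-1.
      by field; rewrite kn vn.
    rewrite lef_pV2 ?posrE ?(mulr_gt0 (exprn_gt0 2 cv)) // ler_pM2l //.
    exact: exprn_gt0.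
  rewrite mulrDl (@le_trans _ _ (cabs a * (ka ^- 2 + ka^-1) * cabs v ^- 3)) //.
    by rewrite -mulrA mulrDl mulrDr lerD // ler_wpM2l.
  by rewrite lerDl mulr_ge0 // invr_ge0 exprn_ge0 // ltW.
pose G := g2 + 12 * d * g3.
exists (2 / d), G; split; first by rewrite divr_gt0.
- by rewrite addr_ge0 // !mulr_ge0 // ltW.
- move=> v; have m0 := majorant_ge0 M v.
  pose s k := if (v == a) || (v \notin M) then 0 else
              k.+1%:R / (v - a) ^+ k.+2 - (if k is 0%N then v ^- 2 else 0).
  exists s; last first.
    rewrite /s /wterm' /wterm; case: eqP => //= /eqP va; case: (boolP (v \in M)) => //= vM.
    by rewrite mul1r -(opprB v a) sqrrN.
  split=> [|n z z0 hz]; first by rewrite divr_gt0.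
  have x0 : 0 <= 2 / d * cabs z by rewrite !mulr_ge0 ?cabs_ge0 // invr_ge0 ltW.
  rewrite /wterm' /wterm.
  case: (boolP ((v == a) || (v \notin M))) => hv.
    rewrite (_ : taylor s n z = 0); last by rewrite /taylor big1 // => k _; rewrite /s hv mul0r.
    rewrite (_ : (if v == a then _ else _) = 0).
      by rewrite subrr cabs0 !mulr_ge0 ?exprn_ge0 // addr_ge0 // !mulr_ge0 // ltW.
    by move: hv; case: eqP => //= _ /negbTE ->.
  move: (hv); rewrite negb_or negbK => /andP[va vM].
  rewrite (negbTE va) vM; have Mv : M v by rewrite in_setE in vM.
  have trE m : taylor s m.+1 z = taylor (fun k => k.+1%:R / (v - a) ^+ k.+2) m.+1 z - v ^- 2.
    rewrite /taylor !big_ord_recl /s (negbTE hv) expr0 !mulr1 addrAC; congr (_ + _ + _).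
    by apply: eq_bigr => k _; rewrite subr0.
  have rem m : cabs ((a + z - v) ^- 2 - v ^- 2 - taylor s m.+1 z) <=
      12 * d * g3 * majorant M v * (2 / d * cabs z) ^+ m.+1.
    rewrite trE opprB addrA subrK (_ : a + z - v = z - (v - a)); last by ring.
    apply: le_trans (inv_sqr_remainder _ d0 (hd v Mv va) hz) _.
    rewrite ler_wpM2r ?exprn_ge0 // -!mulrA ler_wpM2l // ler_wpM2l ?(ltW d0) //.
    exact: h3.
  have gm : 12 * d * g3 * majorant M v <= G * majorant M v.
    by rewrite ler_wpM2r // /G lerDr.
  (* In order 0 the remainder is the term itself, which without its value at [a] has no cubic decay;
     it is bounded by the remainder of order 1 plus that value. Hence the two parts of [G]. *)
  case: n => [|n].
    rewrite taylor0 subr0 expr0 mulr1.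
    have := rem 0%N; rewrite taylorS taylor0 add0r !expr1 expr0 mulr1 => r1.
    have s0 : s 0%N = wterm' M a a v.
      by rewrite /s /wterm' /wterm (negbTE hv) (negbTE va) vM mul1r -(opprB v a) sqrrN.
    have := h2 v; rewrite -s0 => r2.
    have := cabsD ((a + z - v) ^- 2 - v ^- 2 - s 0%N) (s 0%N); rewrite subrK => r3.
    have : 12 * d * g3 * majorant M v * (2 / d * cabs z) <= 12 * d * g3 * majorant M v * 1.
      by rewrite ler_wpM2l // !mulr_ge0 // ltW.
    by rewrite /G; lra.
  by apply: le_trans (rem n) _; rewrite ler_wpM2r // exprn_ge0.
by move=> v; apply: le_trans (h2 v) _; rewrite ler_wpM2r ?majorant_ge0 // /G lerDl !mulr_ge0 // ltW.
Qed.

Lemma has_sum_wterm M e u : subgroup M -> udiscrete M e -> has_sum (wterm M u) (wpf M u).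
Proof.
move=> sM ue; have [K [G [_ G0 _ hG]]] := wterm_germ u sM ue.
have [D hD] := sum_majorant sM ue.
have [x hx] : exists x, has_sum (wterm' M u u) x.
  apply: (@has_sum_dom _ _ (G * D)) => B.
  apply: le_trans (_ : \sum_(v <- B) G * majorant M v <= _); first exact: ler_sum.
  by rewrite -mulr_sumr ler_wpM2l.
have h : has_sum (wterm M u) (x + wterm M u u).
  apply: eq_has_sum (has_sumD hx (has_sum1 u (wterm M u u))) => v.
  by rewrite /wterm'; case: eqP => [->|_]; rewrite ?add0r ?addr0.
by rewrite /wpf (has_sum_sum h).
Qed.

Lemma wpE M e u : subgroup M -> udiscrete M e ->
  wp M u = if u \in M then None else Some (wpf M u).
Proof.
move=> sM ue; rewrite /wp; case: ifP => // _; congr Some.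
have h := has_sum_wterm u sM ue.
have M0 : 0 \in M by rewrite in_setE; exact: sM.1.
have h' := has_sumB h (has_sum1 0 (u ^- 2)).
have -> : wpf M u = u ^- 2 + (wpf M u - u ^- 2) by ring.
rewrite -(has_sum_sum h').
suff -> : (fun v : C => if v \in M `\ 0 then (u - v) ^- 2 - v ^- 2 else 0) =
  (fun v => wterm M u v - (if v == 0 then u ^- 2 else 0)) by [].
apply/funext => v; rewrite /wterm; case: eqP => [->|/eqP v0].
  rewrite M0 (_ : 0 \in M `\ 0 = false); last by apply/negP; rewrite in_setE => -[_ /=]; exact.
  by rewrite expr0n invr0 !subr0 subrr.
rewrite subr0 (_ : (v \in M `\ 0) = (v \in M)) //.
apply/idP/idP; rewrite !in_setE; first by case.
by move=> Mv; split=> // /= e0; rewrite e0 eqxx in v0.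
Qed.

Lemma wpf_even M e u : subgroup M -> udiscrete M e -> wpf M (- u) = wpf M u.
Proof.
move=> sM ue; apply: has_sum_uniq (has_sum_wterm _ sM ue) _.
apply: eq_has_sum (has_sum_bij opprK opprK (has_sum_wterm u sM ue)) => v /=.
rewrite /wterm subgroupNE //; case: ifP => // _.
by rewrite -opprD !sqrrN opprK -[u + v]opprK opprD sqrrN.
Qed.

(* By reindexing, wp(u + w) - wp(u) does not depend on u; as wp is even, taking
   -u - w for u changes its sign. *)
Lemma wpf_periodic M e u w : subgroup M -> udiscrete M e -> M w -> wpf M (u + w) = wpf M u.
Proof.
move=> sM ue Mw.
have key x y : wpf M (x + w) - wpf M (y + w) = wpf M x - wpf M y.
  have hs := has_sumB (has_sum_wterm x sM ue) (has_sum_wterm y sM ue).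
  apply: has_sum_uniq (has_sumB (has_sum_wterm (x + w) sM ue) (has_sum_wterm (y + w) sM ue)) _.
  apply: eq_has_sum (has_sum_bij (subrK w) (addrK w) hs) => v /=.
  rewrite /wterm subgroupBE //; case: ifP => _; last by rewrite !subrr.
  have eq1 z : z + w - v = z - (v - w) by ring.
  by rewrite !eq1; ring.
have := key u (- u - w); rewrite subrK -opprD !(wpf_even _ sM ue) => h.
apply/eqP; rewrite -subr_eq0.
have : (wpf M (u + w) - wpf M u) *+ 2 = 0.
  by rewrite mulr2n {1}h; ring.
by move=> /eqP; rewrite mulrn_eq0.
Qed.

End Weierstrass.

(** * Regular functions and Liouville's theorem *)

Section Regularity.
Variable R : realType.
Local Notation C := (R[i]).
Implicit Types (M : set C) (a b c z u v w : C) (f g : C -> C).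

(** Germs ignore the value at the centre, so [reg] admits a removable singularity with an arbitrary
    value there; [ana] also requires the right value. *)
Definition reg f a : Prop := exists s, germ f a s.
Definition ana f a : Prop := exists2 s, germ f a s & s 0%N = f a.

Lemma ana_reg f a : ana f a -> reg f a. Proof. by case=> s; exists s. Qed.

Lemma eq_ana f g a : f =1 g -> ana f a -> ana g a.
Proof. by move=> /funext ->. Qed.

Lemma ana_cst a c : ana (fun=> c) a.
Proof. by exists (fun k => if k is 0%N then c else 0) => //; exact: germ_cst. Qed.

Lemma anaD f g a : ana f a -> ana g a -> ana (fun z => f z + g z) a.
Proof.
by move=> [s hs s0] [t ht t0]; exists (fun k => s k + t k); rewrite ?s0 ?t0 //; exact: germD.
Qed.

Lemma anaN f a : ana f a -> ana (fun z => - f z) a.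
Proof. by move=> [s hs s0]; exists (fun k => - s k); rewrite ?s0 //; exact: germN. Qed.

Lemma anaB f g a : ana f a -> ana g a -> ana (fun z => f z - g z) a.
Proof. by move=> hf /anaN; exact: anaD. Qed.

Lemma anaM f g a : ana f a -> ana g a -> ana (fun z => f z * g z) a.
Proof.
move=> [s hs s0] [t ht t0]; exists (cauchy s t); first exact: germM.
by rewrite /cauchy big_ord1 subnn s0 t0.
Qed.

Lemma anaZ f a c : ana f a -> ana (fun z => c * f z) a.
Proof. by apply: anaM; exact: ana_cst. Qed.

Lemma anaX f a n : ana f a -> ana (fun z => f z ^+ n) a.
Proof.
move=> hf; elim: n => [|n IH]; first exact: (eq_ana (fun z => esym (expr0 (f z)))) (ana_cst a 1).
by apply: eq_ana (anaM hf IH) => z; rewrite exprS.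
Qed.

Lemma ana_sub a b : ana (fun z => z - b) a.
Proof.
have [s hs s0] := germ_id a.
exists (fun k => s k + (if k is 0%N then a - b else 0)); last by rewrite s0 add0r.
by apply: eq_germ (germD hs (germ_cst a (a - b))) => z; rewrite addrA subrK.
Qed.

Lemma ana_id a : ana id a.
Proof. by apply: eq_ana (ana_sub a 0) => z; rewrite subr0. Qed.

Lemma ana_horner (p : {poly C}) f a : ana f a -> ana (fun z => p.[f z]) a.
Proof.
move=> hf; elim/poly_ind: p => [|p c IH].
  by apply: eq_ana (ana_cst a 0) => z; rewrite horner0.
by apply: eq_ana (anaD (anaM IH hf) (ana_cst a c)) => z; rewrite !hornerE.
Qed.

Lemma ana_translate f a b : ana f (a + b) -> ana (fun z => f (z + b)) a.
Proof. by move=> [s hs s0]; exists s => //; exact: germ_translate. Qed.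

Lemma ana_cvg f a (e : R) : ana f a -> 0 < e ->
  exists2 r : R, 0 < r & forall z, cabs z <= r -> cabs (f (a + z) - f a) < e.
Proof.
move=> [s hs s0] e0; have [r r0 hr] := germ_cvg hs e0; exists r => // z hz.
by have [->|z0] := eqVneq z 0; [rewrite addr0 subrr cabs0|rewrite -s0; exact: hr].
Qed.

Lemma ana_factor f a : ana f a ->
  exists2 g, ana g a & forall u, f u = f a + (u - a) * g u.
Proof.
move=> [s hs s0]; pose g u := if u == a then s 1%N else (f u - f a) / (u - a).
exists g => [|u].
  exists (fun k => s k.+1); last by rewrite /g eqxx.
  apply: germ_ext (ltr01 : 0 < 1 :> R) _ (germ_shift hs) => z z0 _.
  by rewrite /g (_ : (a + z == a) = false) ?s0 //; rewrite -subr_eq0 addrC addKr (negbTE z0).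
rewrite /g; case: eqP => [->|/eqP ua]; first by rewrite subrr mul0r addr0.
by rewrite mulrC divfK ?subr_eq0 // addrC subrK.
Qed.

(** Evenness kills the linear coefficient, so the factor u splits off twice. The cofactor is even
    again, which permits a second application. *)
Lemma ana_even f : (forall u, f (- u) = f u) -> ana f 0 ->
  exists2 g, ana g 0 /\ (forall u, g (- u) = g u) & forall u, f u = f 0 + u ^+ 2 * g u.
Proof.
move=> fe hf; have [g hg eg] := ana_factor hf.
have g0 : g 0 = 0.
  case: hg => s hs s0; rewrite -s0; case: hf => t ht t0.
  have hsh : germ g 0 (fun k => t k.+1).
    apply: germ_ext (ltr01 : 0 < 1 :> R) _ (germ_shift ht) => z z0 _.
    by rewrite add0r eg t0 subr0 addrC addKr mulrC mulKf.
  by rewrite (germ_uniq hs hsh 0%N); exact: germ_even fe ht 1%N (erefl _).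
have [h hh eh] := ana_factor hg.
exists (fun u => if u == 0 then h 0 else h u) => [|u].
  split=> [|u]; first by apply: eq_ana hh => u; case: eqP => [->|].
  rewrite oppr_eq0; case: eqP => // /eqP u0.
  have := fe u; rewrite (eg (- u)) (eg u) (eh (- u)) (eh u) g0 !subr0 !add0r => /addrI.
  by rewrite !mulNr mulrN opprK => /(mulfI u0)/(mulfI u0).
case: eqP => [->|_]; first by rewrite expr0n mul0r addr0.
by rewrite (eg u) (eh u) g0 !subr0 add0r expr2 mulrA.
Qed.

Lemma reg_ext f g a (r : R) : 0 < r ->
  (forall z, z != 0 -> cabs z <= r -> f (a + z) = g (a + z)) -> reg f a -> reg g a.
Proof. by move=> r0 fg [s hs]; exists s; apply: germ_ext r0 fg hs. Qed.

End Regularity.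

(** * Periodic functions and Liouville's theorem *)

Section Liouville.
Variable R : realType.
Local Notation C := (R[i]).
Implicit Types (a b c z u v w : C) (f g : C -> C).

Definition Rindep v w : Prop :=
  complex.Re v * complex.Im w - complex.Im v * complex.Re w != 0.

Lemma Rindep_basis v w : Rindep v w ->
  forall u, exists x y : R, u = x%:C%C * v + y%:C%C * w.
Proof.
rewrite /Rindep; case: v => a b; case: w => c d /= hd [p q].
pose D := a * d - b * c.
exists ((p * d - q * c) / D), ((a * q - b * p) / D).
apply/eqP; rewrite eq_complex /= !mul0r !subr0 !addr0; apply/andP; split; apply/eqP;
  by rewrite /D; field.
Qed.

Lemma mod_basis (S : set C) v w : subgroup S -> S v -> S w -> Rindep v w ->
  forall u, exists2 m, S m & exists x y : R, [/\ 0 <= x <= 1, 0 <= y <= 1 &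
     u - m = x%:C%C * v + y%:C%C * w].
Proof.
move=> sS Sv Sw hvw u; have [x [y ->]] := Rindep_basis hvw u.
have Sint t k : S t -> S (k%:~R * t).
  move=> St; have Sn n : S (n%:R * t).
    elim: n => [|n IH]; first by rewrite mul0r; exact: sS.1.
    by rewrite -natr1 mulrDl mul1r; exact: subgroupD.
  case: k => n; first exact: Sn.
  by rewrite NegzE mulrNz mulNr; apply: subgroupN => //; exact: Sn.
exists ((Num.floor x)%:~R * v + (Num.floor y)%:~R * w).
  by apply: subgroupD => //; exact: Sint.
exists (x - (Num.floor x)%:~R), (y - (Num.floor y)%:~R).
have fl (t : R) : 0 <= t - (Num.floor t)%:~R <= 1.
  have h1 := ge_floor t; have h2 := floorD1_gt t; move: h2; rewrite intrD => h2.
  by apply/andP; split; lra.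
split; rewrite ?fl // !rmorphB /= !rmorph_int; ring.
Qed.

(** Every point is congruent to one of the parallelogram spanned by [v] and [w], the image of the
    compact unit square. *)
Lemma periodic_max (g : C -> R) (S : set C) v w : subgroup S -> S v -> S w -> Rindep v w ->
  (forall u m, S m -> g (u + m) = g u) ->
  (forall a (e : R), 0 < e -> exists2 r : R, 0 < r &
     forall z, cabs z <= r -> `|g (a + z) - g a| < e) ->
  exists a0, forall u, g u <= g a0.
Proof.
move=> sS Sv Sw hvw gS gc.
pose h (p : R * R) : C := p.1%:C%C * v + p.2%:C%C * w.
pose G := g \o h.
pose K : set (R * R) := `[0, 1] `*` `[0, 1].
have cK : compact K by apply: compact_setX; exact: segment_compact.
have cG : continuous G.
  move=> p; apply/cvgrPdist_lt => e e0; have [r r0 hr] := gc (h p) e e0.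
  have D0 : 0 < cabs v + cabs w + 1 by rewrite ltr_wpDl ?addr_ge0 ?cabs_ge0.
  have d0 := divr_gt0 r0 D0.
  exists (ball p.1 (r / (cabs v + cabs w + 1)), ball p.2 (r / (cabs v + cabs w + 1))).
    by split; exact: nbhsx_ballx.
  move=> q /= [/= h1 h2]; rewrite distrC /G /=.
  rewrite (_ : h q = h p + (h q - h p)); last by rewrite addrC subrK.
  apply: hr; rewrite (_ : h q - h p = (q.1 - p.1)%:C%C * v + (q.2 - p.2)%:C%C * w); last first.
    by rewrite /h !rmorphB /=; ring.
  apply: le_trans (cabsD _ _) _; rewrite !cabsM !cabs_real.
  move: h1 h2; rewrite /ball /= -!(distrC p.1) -!(distrC p.2) !ltr_pdivlMr // => h1 h2.
  have := cabs_ge0 v; have := cabs_ge0 w; have := normr_ge0 (p.1 - q.1); have := normr_ge0 (p.2 - q.2).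
  move: h1 h2; set A := `|_|; set B := `|_|; set V := cabs v; set W := cabs w.
  have [AB|AB] := leP A B; nra.
have K0 : K !=set0 by exists (0, 0); split; rewrite /= in_itv /= lexx ler01.
have cGK : {within K, continuous G} by apply: continuous_subspaceT.
have [p _ hp] := compact_EVT_max K0 cK cGK.
exists (h p) => u; have [m Sm [x [y [hx hy e]]]] := mod_basis sS Sv Sw hvw u.
have -> : u = h (x, y) + m by rewrite /h /= -e subrK.
rewrite gS //; apply: (hp (x, y)); rewrite in_setE; split; rewrite /= in_itv /=; assumption.
Qed.

(** [F] fills in the removable singularities, which lie in [E]; as [E] is isolated, [F] has the
    germs of [f]. By periodicity |F| attains its maximum at some [a0], and the set where F = F(a0)
    is closed by continuity and open by [germ_maxmod]. *)
Lemma liouville f (E : C -> Prop) (S : set C) v w :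
  subgroup S -> S v -> S w -> Rindep v w ->
  (forall u m, S m -> f (u + m) = f u) ->
  (forall a, reg f a) -> (forall a, ~ E a -> ana f a) ->
  (forall a, exists2 r : R, 0 < r & forall z, z != 0 -> cabs z <= r -> ~ E (a + z)) ->
  exists D, forall u, ~ E u -> f u = D.
Proof.
move=> sS Sv Sw hvw fS fr fa fE.
have [s hs] := choice fr; pose F a := s a 0%N.
have Ff a : ~ E a -> F a = f a.
  by move=> /fa[t ht <-]; exact: germ_uniq (hs a) ht 0%N.
have FS u m : S m -> F (u + m) = F u.
  move=> Sm; apply: (@germ_uniq _ f u); last exact: hs.
  by apply: eq_germ (germ_translate (hs (u + m))) => z; exact: fS.
have Fg a : germ F a (s a).
  have [r r0 hr] := fE a; apply: germ_ext r0 _ (hs a) => z z0 zr.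
  by rewrite Ff //; exact: hr.
have Fc a (e : R) : 0 < e -> exists2 r : R, 0 < r & forall z, cabs z <= r -> cabs (F (a + z) - F a) < e.
  by apply: ana_cvg; exists (s a).
have [||a0 ha0] := @periodic_max (fun u => cabs (F u)) S v w sS Sv Sw hvw.
- by move=> u m Sm; rewrite FS.
- move=> a e e0; have [r r0 hr] := Fc a e e0; exists r => // z /hr h.
  have h1 := cabsBr (F (a + z)) (- F a); have h2 := cabsBr (F a) (- F (a + z)).
  move: h1 h2; rewrite !cabsN (cabsC (F a)) => h1 h2.
  by rewrite ltr_norml; apply/andP; split; lra.
exists (F a0) => u /Ff <-; move: u; apply: (@clopen_all _ _ a0) => // [u Fu|u hu].
  have hm z : z != 0 -> cabs z <= 1 -> cabs (F (u + z)) <= cabs (s u 0%N).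
    by move=> _ _; rewrite -/(F u) Fu.
  have [r r0 hr] := germ_maxmod (Fg u) ltr01 hm; exists r => // z zr.
  by have [->|z0] := eqVneq z 0; [rewrite addr0|rewrite hr // -Fu].
apply/eqP; rewrite eq_sym -subr_eq0 -cabs_eq0 eq_le cabs_ge0 andbT.
apply/ler_addgt0Pr => e e0; rewrite add0r; have [r r0 hr] := Fc u e e0.
have [z zr <-] := hu r r0; exact/ltW/hr.
Qed.

End Liouville.

(** * Addition formula and passage to a superlattice *)

Section Addition.
Variable R : realType.
Local Notation C := (R[i]).
Implicit Types (M N : set C) (a b c z u v w : C).

Lemma wpf_ana_term M e a : subgroup M -> udiscrete M e ->
  ana (fun u => wpf M u - wterm M u a) a.
Proof.
move=> sM ue; have [K [G [K0 G0 hg _]]] := wterm_germ a sM ue.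
have [D hD] := sum_majorant sM ue.
have hs u : has_sum (wterm' M a u) (wpf M u - wterm M u a).
  apply: eq_has_sum (has_sumB (has_sum_wterm u sM ue) (has_sum1 a (wterm M u a))) => v.
  by rewrite /wterm'; case: eqP => [->|_]; rewrite ?subrr ?subr0.
have : forall v, exists s, germ_bound (fun u => wterm' M a u v) a s (G * majorant M v) K /\
    s 0%N = wterm' M a a v by move=> v; have [s] := hg v; exists s.
move=> /choice[s hs'].
have [|||S hS hS0] := @germ_has_sum _ (fun v u => wterm' M a u v) s (fun v => G * majorant M v)
    a K (G * D) (fun u => wpf M u - wterm M u a).
- by move=> v; have [] := hs' v.
- by move=> B; rewrite -mulr_sumr ler_wpM2l.
- by move=> z _ _; exact: hs.
exists S => //; apply: has_sum_uniq (hS0 0%N) _.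
by apply: eq_has_sum (hs a) => v; have [] := hs' v.
Qed.

Lemma wpf_ana M e a : subgroup M -> udiscrete M e -> ~ M a -> ana (wpf M) a.
Proof.
move=> sM ue Ma; apply: eq_ana (wpf_ana_term a sM ue) => u.
by rewrite /wterm memNset // subr0.
Qed.

Lemma wpf0 M e : subgroup M -> udiscrete M e -> wpf M 0 = 0.
Proof.
move=> sM ue; apply: has_sum_uniq (has_sum_wterm 0 sM ue) _.
by apply: eq_has_sum (@has_sum0 R) => v; rewrite /wterm sub0r sqrrN subrr if_same.
Qed.

(** The function wp(u) - u^-2 is even and vanishes at 0, as each of its terms does, so u^2 can be
    factored out. *)
Lemma wpf_pole M e : subgroup M -> udiscrete M e ->
  exists2 g, ana g 0 & forall u, wpf M u = u ^- 2 + u ^+ 2 * g u.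
Proof.
move=> sM ue; pose W u := wpf M u - u ^- 2.
have W0 : W 0 = 0 by rewrite /W (wpf0 sM ue) expr0n invr0 subrr.
have hW : ana W 0.
  apply: eq_ana (wpf_ana_term 0 sM ue) => u; rewrite /wterm mem_set; last exact: sM.1.
  by rewrite expr0n invr0 !subr0.
have eW u : W (- u) = W u by rewrite /W (wpf_even _ sM ue) sqrrN.
have [g [hg _] eg] := ana_even eW hW; exists g => // u.
by have := eg u; rewrite W0 add0r => <-; rewrite /W addrC subrK.
Qed.

Lemma udiscrete_isolated M e b : subgroup M -> udiscrete M e ->
  exists2 r : R, 0 < r & forall z, z != 0 -> cabs z <= r -> ~ M (b + z).
Proof.
move=> sM ue; have [d d0 hd] := dist_to_group b sM ue.
exists (d / 2); first by rewrite divr_gt0.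
move=> z z0 hz /hd; rewrite addrC addrK -subr_eq0 addrK => /(_ z0); lra.
Qed.

Lemma reg_translate (f : C -> C) a m : (forall u, f (u + m) = f u) -> reg f a -> reg f (a + m).
Proof.
move=> fm [s hs]; exists s; have h : germ f (a + m + - m) s by rewrite addrK.
by apply: eq_germ (germ_translate h) => z; rewrite -(fm (z - m)) subrK.
Qed.

Section AdditionAt.
Variables (M : set C) (e : R) (c : C).
Hypotheses (sM : subgroup M) (ue : udiscrete M e) (Mc : ~ M c).

Let x u := wpf M u.
Let h u := x (u + c) + x (u - c).

Let hE u : h (- u) = h u.
Proof.
rewrite /h /x -(wpf_even (- u + c) sM ue) -(wpf_even (- u - c) sM ue).
by rewrite !opprD !opprK addrC.
Qed.

Let McN : ~ M (- c).
Proof. by move=> /(subgroupN sM); rewrite opprK. Qed.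

Let h0 : ana h 0.
Proof.
by apply: anaD; apply: ana_translate; rewrite add0r; apply: (wpf_ana sM ue).
Qed.

(* The coefficients A and B cancel the poles of order 4 and 2 at the lattice
   points, so that the difference is entire and periodic. *)
Let F (A B : C) u := (x u - x c) ^+ 2 * h u - A * x u ^+ 2 - B * x u.

Let reg_F0 : exists A B, reg (F A B) 0.
Proof.
have [w hw xw] := wpf_pole sM ue.
have [h' [hh' h'E] eh] := ana_even hE h0.
have [h4 [hh4 _] eh'] := ana_even h'E hh'.
(* With x = u^-2 + O(u^2) and h = h(0) + h'(0) u^2 + O(u^4), where h' is the cofactor and not the
   derivative, these are the coefficients of u^-4 and u^-2 in (x - x(c))^2 h. *)
exists (h 0), (h' 0 - 2 * x c * h 0).
pose xi u := 1 + u ^+ 4 * w u.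
apply: (@reg_ext _ (fun u => xi u * (h4 u + u ^+ 2 * w u * h' u) - 2 * x c * (xi u * h' u)
   + x c ^+ 2 * h u) _ 0 1) => // [z z0 _|].
  rewrite add0r /F /xi (_ : x z = z ^- 2 + z ^+ 2 * w z); last exact: xw.
  rewrite (eh z) (eh' z); by field.
have axi : ana xi 0.
  apply: anaD; first exact: ana_cst.
  by apply: anaM hw; apply: anaX; exact: ana_id.
apply: ana_reg; apply: anaD; last exact: anaZ.
apply: anaB; last by apply: anaZ; exact: anaM.
apply: anaM axi _; apply: anaD hh4 _; apply: anaM hh'; apply: anaM hw.
by apply: anaX; exact: ana_id.
Qed.

(** At [c] the double pole of x(u - c) meets a zero of (x - x(c))^2 of order at least two. *)
Let reg_Fc A B : reg (F A B) c.
Proof.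
have [w hw xw] := wpf_pole sM ue.
have ax : ana x c by exact: (wpf_ana sM ue).
have [k hk xk] := ana_factor ax.
have aw : ana (fun u => w (u - c)) c by apply: ana_translate; rewrite subrr.
have asub n : ana (fun u => (u - c) ^+ n) c by apply: anaX; exact: ana_sub.
have xwc z : x (c + z - c) = z ^- 2 + z ^+ 2 * w z by rewrite addrC addKr; exact: xw.
have awc z : w (c + z - c) = w z by rewrite addrC addKr.
have aAB : ana (fun u => A * x u ^+ 2 + B * x u) c.
  by apply: anaD; apply: anaZ => //; exact: anaX.
have ak2 : ana (fun u => k u ^+ 2) c by exact: anaX.
have a4 : ana (fun u => 1 + (u - c) ^+ 4 * w (u - c)) c.
  by apply: anaD; [exact: ana_cst|exact: anaM].
(* If 2c is in [M], then x(u + c) has a pole at [c] as well; by periodicity it equals x(u - c), and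
   the same cancellation applies to both. *)
have [M2c|M2c] := pselect (M (c + c)).
  apply: (@reg_ext _ (fun u => k u ^+ 2 * (1 + (u - c) ^+ 4 * w (u - c)) * 2
     - (A * x u ^+ 2 + B * x u)) _ c 1) => // [z z0 _|].
    have e1 : x (c + z + c) = x (c + z - c).
      by rewrite /x -(wpf_periodic (c + z - c) sM ue M2c); congr wpf; ring.
    rewrite /F /h e1 xwc awc (_ : c + z - c = z); last by rewrite addrC addKr.
    rewrite [in X in _ = X - _ - _](xk (c + z)) (_ : c + z - c = z); last by rewrite addrC addKr.
    by field.
  by apply: ana_reg; apply: anaB aAB; apply: anaM (ana_cst _ _); exact: anaM.
have ax2 : ana (fun u => x (u + c)) c by apply: ana_translate; exact: (wpf_ana sM ue).
apply: (@reg_ext _ (fun u => (u - c) ^+ 2 * k u ^+ 2 * x (u + c) +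
     k u ^+ 2 * (1 + (u - c) ^+ 4 * w (u - c)) - (A * x u ^+ 2 + B * x u)) _ c 1) => // [z z0 _|].
  rewrite /F /h xwc awc (_ : c + z - c = z); last by rewrite addrC addKr.
  rewrite [in X in _ = X - _ - _](xk (c + z)) (_ : c + z - c = z); last by rewrite addrC addKr.
  by field.
by apply: ana_reg; apply: anaB aAB; apply: anaD; apply: anaM => //; exact: anaM.
Qed.

Lemma wpf_addition v w : M v -> M w -> Rindep v w ->
  exists A B D, forall u, ~ M u -> ~ M (u - c) -> ~ M (u + c) ->
    (wpf M u - wpf M c) ^+ 2 * (wpf M (u + c) + wpf M (u - c)) =
    A * wpf M u ^+ 2 + B * wpf M u + D.
Proof.
move=> Mv Mw hvw; have [A [B r0]] := reg_F0.
have xm u m : M m -> x (u + m) = x u by exact: wpf_periodic sM ue.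
have FM u m : M m -> F A B (u + m) = F A B u.
  move=> Mm; have e1 b : x (u + m + b) = x (u + b) by rewrite addrAC; exact: xm.
  by rewrite /F /h !e1 (xm u m Mm).
pose E u := M u \/ M (u - c) \/ M (u + c).
have FE u : F A B (- u) = F A B u by rewrite /F hE /x (wpf_even _ sM ue).
have rNc : reg (F A B) (- c).
  have [s hs] := reg_Fc A B; rewrite -[c]opprK in hs.
  by exists (fun k => (-1) ^+ k * s k); exact: eq_germ FE (germ_opp hs).
have aF a : ~ E a -> ana (F A B) a.
  move=> /not_orP[Ma /not_orP[Ma1 Ma2]].
  have ax : ana x a by exact: (wpf_ana sM ue).
  have ah : ana h a by apply: anaD; apply: ana_translate; exact: (wpf_ana sM ue).
  apply: anaB; last exact: anaZ.
  apply: anaB; last by apply: anaZ; exact: anaX.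
  apply: anaM ah; apply: anaX; apply: anaB => //; exact: ana_cst.
have rF a : reg (F A B) a.
  have [[Ma|[Ma|Ma]]|/aF/ana_reg//] := pselect (E a).
  - by rewrite -[a]add0r; apply: reg_translate r0 => u; exact: FM.
  - by rewrite -(subrK c a) addrC; apply: reg_translate (reg_Fc A B) => u; exact: FM.
  - by rewrite -(addrK c a) addrC; apply: reg_translate rNc => u; exact: FM.
have iE a : exists2 r : R, 0 < r & forall z, z != 0 -> cabs z <= r -> ~ E (a + z).
  have [r r0' hr] := udiscrete_isolated a sM ue.
  have [r1 r10 hr1] := udiscrete_isolated (a - c) sM ue.
  have [r2 r20 hr2] := udiscrete_isolated (a + c) sM ue.
  exists (Num.min r (Num.min r1 r2)); first by rewrite !lt_min r0' r10.
  move=> z z0; rewrite !le_min => /and3P[z1 z2 z3] [|[]]; first exact: hr.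
    by rewrite addrAC; exact: hr1.
  by rewrite addrAC; exact: hr2.
have [D hD] := liouville sM Mv Mw hvw FM rF aF iE.
exists A, B, D => u u1 u2 u3; rewrite -(hD u).
  by rewrite /F /h /x; ring.
by move=> [|[]].
Qed.

End AdditionAt.

(** The series for wp_N(u - c) - wp_N(-c), shifted by [c], has the terms (u - v)^-2 - v^-2 with v in
    c + N: subtracting the constant trades the correction terms of [N] for those of [M]. *)
Lemma wpf_coset_sum M N e (rs : seq C) u : subgroup M -> subgroup N -> udiscrete M e -> N `<=` M ->
  uniq rs -> (forall c, c \in rs -> M c) ->
  (forall v, M v -> exists2 c, c \in rs & N (v - c)) ->
  (forall c c', c \in rs -> c' \in rs -> N (c - c') -> c = c') ->
  wpf M u = \sum_(c <- rs) (wpf N (u - c) - wpf N (- c)).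
Proof.
move=> sM sN ue NM urs rsM rsc rsi.
have ueN : udiscrete N e by split=> [|v Nv]; [exact: ue.1|apply: ue.2; exact: NM].
apply: has_sum_uniq (has_sum_wterm u sM ue) _.
have hc c : has_sum (fun v => if v - c \in N then (u - v) ^- 2 - v ^- 2 else 0)
                    (wpf N (u - c) - wpf N (- c)).
  have := has_sumB (has_sum_wterm (u - c) sN ueN) (has_sum_wterm (- c) sN ueN).
  move=> /(has_sum_bij (subrK c) (addrK c)); apply: eq_has_sum => v /=.
  rewrite /wterm; case: ifP => _; last by rewrite subr0.
  have -> : u - c - (v - c) = u - v by ring.
  have -> : (- c - (v - c)) ^+ 2 = v ^+ 2 by ring.
  by ring.
apply: eq_has_sum (has_sum_big rs hc) => v; rewrite /wterm; case: ifPn => vM.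
  have [c crs Nvc] : exists2 c, c \in rs & N (v - c) by apply: rsc; rewrite in_setE in vM.
  rewrite (bigD1_seq c) //= mem_set // big_seq_cond big1 ?addr0 // => c' /andP[c'rs c'c].
  case: ifPn => //; rewrite in_setE => Nvc'; case/negP: c'c; apply/eqP.
  by apply: rsi => //; rewrite (_ : c' - c = v - c - (v - c')); [exact: sN.2|ring].
rewrite big_seq big1 // => c crs; case: ifPn => //; rewrite in_setE => /NM Mvc.
by case/negP: vM; rewrite in_setE -(subrK c v); apply: subgroupD => //; exact: rsM.
Qed.

Lemma wpf_relation M N e (rs : seq C) v w :
  subgroup M -> subgroup N -> udiscrete M e -> N `<=` M -> uniq rs -> (forall c, c \in rs -> M c) ->
  (forall v, M v -> exists2 c, c \in rs & N (v - c)) ->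
  (forall c c', c \in rs -> c' \in rs -> N (c - c') -> c = c') ->
  N v -> N w -> Rindep v w ->
  exists2 Q : {poly C}, Q != 0 & exists P : {poly C}, forall u, ~ M u ->
    Q.[wpf N u] * wpf M u = P.[wpf N u].
Proof.
move=> sM sN ue NM urs rsM rsc rsi Nv Nw hvw.
have ueN : udiscrete N e by split=> [|x Nx]; [exact: ue.1|apply: ue.2; exact: NM].
have one c : M c -> exists2 Q : {poly C}, Q != 0 & exists P : {poly C}, forall u, ~ M u ->
    Q.[wpf N u] * (wpf N (u + c) + wpf N (u - c)) = P.[wpf N u].
  move=> Mc; have [Nc|Nc] := pselect (N c).
    exists 1; first exact: oner_neq0.
    exists (2%:P * 'X) => u _; rewrite (wpf_periodic _ sN ueN Nc).
    by rewrite (wpf_periodic _ sN ueN (subgroupN sN Nc)) !hornerE; ring.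
  have [A [B [D h]]] := wpf_addition sN ueN Nc Nv Nw hvw.
  exists (('X - (wpf N c)%:P) ^+ 2); first by rewrite expf_neq0 // polyXsubC_eq0.
  exists (A *: 'X^2 + B *: 'X + D%:P) => u Mu.
  have N1 : ~ N (u - c).
    by move=> /NM h1; apply: Mu; rewrite -(subrK c u); exact: subgroupD.
  have N2 : ~ N (u + c) by move=> /NM h1; apply: Mu; rewrite -(addrK c u); exact: sM.2.
  have hu := h u (fun Nu => Mu (NM _ Nu)) N1 N2.
  transitivity (A * wpf N u ^+ 2 + B * wpf N u + D); last by rewrite !hornerE; ring.
  by rewrite -hu !hornerE; ring.
have [Q Q0 [P hP]] : exists2 Q : {poly C}, Q != 0 & exists P : {poly C}, forall u, ~ M u ->
    Q.[wpf N u] * (\sum_(c <- rs) (wpf N (u + c) + wpf N (u - c))) = P.[wpf N u].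
  have : forall c, c \in rs -> M c := rsM.
  elim: (rs) => [|c r IH] hr.
    by exists 1; [exact: oner_neq0|exists 0 => u _; rewrite big_nil mulr0 horner0].
  have [|Q Q0 [P hP]] := IH; first by move=> c' hc'; apply: hr; rewrite in_cons hc' orbT.
  have [Q' Q'0 [P' hP']] := one c (hr c (mem_head _ _)).
  exists (Q * Q'); first by rewrite mulf_neq0.
  exists (Q * P' + Q' * P) => u Mu.
  by rewrite big_cons !hornerE -hP // -hP' //; ring.
exists (2 *: Q); first by rewrite scaler_eq0 (negbTE Q0) pnatr_eq0.
exists (P - (2 * \sum_(c <- rs) wpf N (- c)) *: Q) => u Mu.
have e1 := wpf_coset_sum u sM sN ue NM urs rsM rsc rsi.
(* As wp_M is even, the coset sums at u and -u both equal wp_M(u); adding them produces the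
   symmetric combination. *)
have := wpf_coset_sum (- u) sM sN ue NM urs rsM rsc rsi.
rewrite (wpf_even _ sM ue) => e2.
have e3 : 2 * wpf M u = \sum_(c <- rs) (wpf N (u + c) + wpf N (u - c)) - 2 * \sum_(c <- rs) wpf N (- c).
  rewrite mulr_natl mulr2n {1}e1 e2 -big_split /= mulr_natl mulr2n -big_split /= -sumrB.
  apply: eq_bigr => c _; rewrite -(wpf_even (u + c) sN ueN) opprD; ring.
by rewrite !hornerE -hP // -mulrA mulrCA e3; ring.
Qed.

End Addition.

(** * Ranks and indices *)

Section Ranks.
Variable R : realType.
Local Notation C := (R[i]).
Implicit Types (M N : set C) (u v w x y z : C).

Lemma rank2_udiscrete M : rank2_lattice M -> exists e, udiscrete M e.
Proof.
case=> sM dM _; have [_ [V nV VM]] := dM 0 sM.1.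
move: nV => /nbhs_ballP[eps /= eps0 hB].
have e0 : 0 < complex.Re eps by move: eps0; rewrite ltcE /= => /andP[].
have ee : eps = (complex.Re eps)%:C%C by rewrite RRe_real // gtr0_real.
exists (complex.Re eps); split=> // v Mv v0; rewrite leNgt; apply/negP => hv.
have Vv : V v by apply: hB; rewrite /ball /= sub0r normrN ee cabsE ltcR.
have : [set 0] v by rewrite -VM; split.
by move=> /= e1; rewrite e1 eqxx in v0.
Qed.

Lemma subgroupMz M v (k : int) : subgroup M -> M v -> M (v *~ k).
Proof.
move=> sM Mv; have Mn n : M (v *+ n).
  by elim: n => [|n IH]; [rewrite mulr0n; exact: sM.1|rewrite mulrS; exact: subgroupD].
case: k => n; first exact: Mn.
by rewrite NegzE mulrNz; apply: subgroupN => //; exact: Mn.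
Qed.

(* The cubic sum bounds the number of points. *)
Lemma card_ball M e (r : R) : subgroup M -> udiscrete M e ->
  exists n : nat, forall s : seq C, uniq s ->
    (forall v, v \in s -> M v /\ cabs v <= r) -> (size s <= n)%N.
Proof.
move=> sM ue; have [D hD] := sum_majorant sM ue.
pose r' := Num.max r 1; have r1 : 1 <= r' by rewrite le_max lexx orbT.
have r0 : 0 < r' by apply: lt_le_trans r1.
exists (Num.trunc (D * r' ^+ 3)) => s us hs.
have hq v : v \in s -> r' ^- 3 <= majorant M v.
  move=> /hs[Mv vr]; rewrite /majorant mem_set //; case: eqP => [_|/eqP v0].
    by rewrite invf_le1 ?exprn_gt0 // exprn_ege1.
  have cv : 0 < cabs v by rewrite cabs_gt0.
  by rewrite lef_pV2 ?posrE ?exprn_gt0 // lerXn2r ?nnegrE ?cabs_ge0 ?(ltW r0) //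
    (le_trans vr) // le_max lexx.
have hsum : (size s)%:R * r' ^- 3 <= D.
  apply: le_trans (hD [fset x in s]%fset).
  have -> : \sum_(v <- [fset x in s]%fset) majorant M v = \sum_(v <- s) majorant M v.
    by apply: perm_big; apply: uniq_perm => // x; rewrite !inE.
  rewrite -sum1_size natr_sum mulr_suml big_seq [leRHS]big_seq.
  by apply: ler_sum => v vs; rewrite mul1r hq.
move: hsum; rewrite ler_pdivrMr ?exprn_gt0 // => h.
have := truncnS_gt (D * r' ^+ 3); move=> /(le_lt_trans h).
by rewrite ltr_nat ltnS.
Qed.

Lemma Zindependent2P (v : 'I_2 -> C) : Zindependent v <->
  forall p q : int, v ord0 *~ p + v ord_max *~ q = 0 -> p = 0 /\ q = 0.
Proof.
split=> [h p q e|h c].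
  have := h (fun i => if i == ord0 then p else q).
  rewrite !big_ord_recl big_ord0 addr0 /= => h'.
  have le : lift ord0 ord0 = ord_max :> 'I_2 by apply: val_inj.
  rewrite le in h'; have {}h' := h' e.
  by have := h' ord0; have := h' ord_max.
rewrite !big_ord_recl big_ord0 addr0.
have le : lift ord0 ord0 = ord_max :> 'I_2 by apply: val_inj.
rewrite le => /h[h1 h2] i.
have [->//|] := eqVneq i ord0; have [->//|] := eqVneq i ord_max.
by case: i => [[|[|]]] //= ?; rewrite -!val_eqE.
Qed.

(* Were v1 = t v0 with t real, the elements k v1 - floor(k t) v0 would be
   infinitely many in a bounded set. *)
Lemma Zindependent_Rindep M e (v : 'I_2 -> C) : subgroup M -> udiscrete M e ->
  (forall i, M (v i)) -> Zindependent v -> Rindep (v ord0) (v ord_max).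
Proof.
move=> sM ue Mv /Zindependent2P vi; apply/negP => /eqP hdet.
have [n hn] := card_ball (cabs (v ord0)) sM ue.
have v0 : v ord0 != 0.
  by apply/eqP => v0; have [] // := vi 1 0; rewrite v0 mul0rz mulr0z addr0.
have [t ht] : exists t : R, v ord_max = t%:C%C * v ord0.
  move: v0 hdet; case: (v ord0) => a b; case: (v ord_max) => c d /= ab hdet.
  have D0 : a ^+ 2 + b ^+ 2 != 0.
    apply: contra ab; rewrite paddr_eq0 ?sqr_ge0 // !sqrf_eq0 => /andP[/eqP-> /eqP->].
    exact/eqP.
  exists ((a * c + b * d) / (a ^+ 2 + b ^+ 2)).
  have ad : a * d = b * c by lra.
  apply/eqP; rewrite eq_complex /= !mul0r subr0 addr0; apply/andP; split; apply/eqP.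
    by rewrite mulrAC; apply: (mulIf D0); rewrite mulfVK //; have := congr1 ( *%R b) ad; lra.
  by rewrite mulrAC; apply: (mulIf D0); rewrite mulfVK //; have := congr1 ( *%R a) ad; lra.
pose f (k : nat) := v ord_max *~ k - v ord0 *~ Num.floor (k%:R * t).
have fM k : M (f k) by apply: sM.2; exact: subgroupMz.
have fE k : f k = (k%:R * t - (Num.floor (k%:R * t))%:~R)%:C%C * v ord0.
  rewrite /f -(mulrzl _ (Posz k)) -(mulrzl (v ord0)) ht.
  by rewrite rmorphB rmorphM /= rmorph_nat rmorph_int -pmulrn; ring.
have fb k : cabs (f k) <= cabs (v ord0).
  rewrite fE cabsM cabs_real -[leRHS]mul1r ler_wpM2r ?cabs_ge0 //.
  have h1 := ge_floor (k%:R * t); have h2 := floorD1_gt (k%:R * t); move: h2; rewrite intrD => h2.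
  rewrite ger0_norm; lra.
have fi : injective f.
  move=> i j /eqP; rewrite -subr_eq0 => /eqP e1.
  have e2 : v ord0 *~ (Num.floor (j%:R * t) - Num.floor (i%:R * t)) +
            v ord_max *~ (i%:Z - j%:Z) = 0.
    by rewrite -e1 /f !mulrzBr; ring.
  by have [_ /eqP] := vi _ _ e2; rewrite subr_eq0 => /eqP [].
have := hn [seq f k | k <- iota 0 n.+1].
rewrite map_inj_uniq // iota_uniq size_map size_iota ltnn => h.
suff : false by []; apply: h => // _ /mapP[k _ ->]; by split.
Qed.

(** Reduction modulo [N] moves any representatives into a bounded set, so a system of pairwise
    incongruent elements has bounded size; one of maximal size meets every coset. *)
Lemma coset_representatives M N e v w : subgroup M -> subgroup N -> udiscrete M e ->
  N `<=` M -> N v -> N w -> Rindep v w ->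
  exists rs : seq C, [/\ uniq rs, forall c, c \in rs -> M c,
    forall v, M v -> exists2 c, c \in rs & N (v - c) &
    forall c c', c \in rs -> c' \in rs -> N (c - c') -> c = c'].
Proof.
move=> sM sN ue NM Nv Nw hvw.
have [n hn] := card_ball (cabs v + cabs w) sM ue.
have red u : exists m, N m /\ cabs (u - m) <= cabs v + cabs w.
  have [m Nm [x [y [/andP[x0 x1] /andP[y0 y1] um]]]] := mod_basis sN Nv Nw hvw u.
  exists m; split=> //; rewrite um; apply: le_trans (cabsD _ _) _; rewrite !cabsM !cabs_real !ger0_norm //.
  by apply: lerD; rewrite ler_piMl ?cabs_ge0.
have [m hm] := choice red.
pose good (s : seq C) := [/\ uniq s, forall c, c \in s -> M c &
  forall c c', c \in s -> c' \in s -> N (c - c') -> c = c'].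
have gsize s : good s -> (size s <= n)%N.
  move=> [us sMs si]; rewrite -(size_map (fun u => u - m u)); apply: hn.
    rewrite map_inj_in_uniq // => x y xs ys exy; apply: si => //.
    rewrite (_ : x - y = m x - m y); first by apply: sN.2; [exact: (hm x).1|exact: (hm y).1].
    have -> : x - y = m x - m y + ((x - m x) - (y - m y)) by ring.
    by rewrite exy subrr addr0.
  move=> _ /mapP[x xs ->]; split; last exact: (hm x).2.
  by apply: sM.2; [exact: sMs|apply: NM; exact: (hm x).1].
pose P k := `[< exists s, good s /\ size s = k >].
have P0 : exists k, P k by exists 0%N; apply/asboolP; exists [::].
have Pn k : P k -> (k <= n)%N by move=> /asboolP[s [gs <-]]; exact: gsize.
case: (ex_maxnP P0 Pn) => k /asboolP[s [gs sk]] kmax.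
have [us sMs si] := gs; exists s; split=> // x Mx.
apply: contrapT => hx.
have hx' c : c \in s -> ~ N (x - c) by move=> cs Nxc; apply: hx; exists c.
have : P k.+1.
  apply/asboolP; exists (x :: s); split; last by rewrite /= sk.
  have xs : x \notin s by apply/negP => /hx'; rewrite subrr; apply; exact: sN.1.
  split; first by rewrite /= xs.
    by move=> c; rewrite in_cons => /orP[/eqP->//|/sMs].
  move=> c c'; rewrite !in_cons => /orP[/eqP->|cs] /orP[/eqP->|cs'] //.
  - by move=> /(hx' _ cs').
  - by move=> /(subgroupN sN); rewrite opprB => /(hx' _ cs).
  - exact: si.
by move=> /kmax; rewrite ltnn.
Qed.

(** [x] and an independent pair of [N] are three elements of [M], hence dependent, and the
    coefficient of [x] cannot vanish. *)
Lemma has_rank_multiple M N x : subgroup N -> N `<=` M ->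
  has_rank 2 N -> has_rank 2 M -> M x -> exists2 k : int, k != 0 & N (x *~ k).
Proof.
move=> sN NM [[v Nv vi] _] [_ hM] Mx.
pose u (i : 'I_3) := if unlift ord_max i is Some j then v j else x.
have uE (j : 'I_2) : u (lift ord_max j) = v j by rewrite /u liftK.
have ux : u ord_max = x by rewrite /u unlift_none.
have uM i : M (u i) by rewrite /u; case: unliftP => [j _|_] //; exact: NM.
have := hM u uM; rewrite /Zindependent => /existsNP[c /not_implyP[c0 cn]].
have sumE : \sum_(i < 3) u i *~ c i = \sum_(j < 2) v j *~ c (lift ord_max j) + x *~ c ord_max.
  rewrite big_ord_recr /= ux; congr (_ + _); apply: eq_bigr => j _.
  have -> : widen_ord (leqnSn 2) j = lift ord_max j.
    by apply: val_inj; rewrite /= /bump leqNgt ltn_ord.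
  by rewrite uE.
rewrite sumE in c0.
exists (c ord_max).
  apply/eqP => cm; apply: cn => i.
  rewrite cm mulr0z addr0 in c0; have ci := vi _ c0.
  by case: (unliftP ord_max i) => [j ->|->].
have -> : x *~ c ord_max = - \sum_(j < 2) v j *~ c (lift ord_max j).
  by apply/eqP; rewrite -addr_eq0 addrC c0.
apply: subgroupN => //; apply: big_ind => [||j _]; [exact: sN.1|by move=> *; exact: subgroupD|].
exact: subgroupMz.
Qed.

Lemma subgroupI M N : subgroup M -> subgroup N -> subgroup (M `&` N).
Proof.
move=> sM sN; split; first by split; [exact: sM.1|exact: sN.1].
by move=> x y [Mx Nx] [My Ny]; split; [exact: sM.2|exact: sN.2].
Qed.

(** Nonzero multiples of an independent pair of [M], chosen to lie in [N], remain independent. *)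
Lemma has_rank2I L M N : subgroup M -> subgroup N -> M `<=` L -> N `<=` L ->
  has_rank 2 L -> has_rank 2 M -> has_rank 2 N -> has_rank 2 (M `&` N).
Proof.
move=> sM sN ML NL rL rM rN; split; last first.
  by move=> v hv; apply: rL.2 => i; apply: ML; exact: (hv i).1.
have [[v Mv vi] _] := rM.
have hk i : exists k : int, k != 0 /\ N (v i *~ k).
  by have [k k0 Nk] := has_rank_multiple sN NL rN rL (ML _ (Mv i)); exists k.
have [k hk'] := choice hk.
exists (fun i => v i *~ k i) => [i|c].
  by split; [exact: subgroupMz|exact: (hk' i).2].
under eq_bigr do rewrite -mulrzA.
move=> /vi h i; have := h i; move=> /eqP; rewrite mulf_eq0 (negbTE (hk' i).1).
by move=> /eqP.
Qed.

End Ranks.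

(** * Values of the rational functions *)

Section Values.
Variable R : realType.
Local Notation C := (R[i]).
Implicit Types (M N : set C) (u v w x y z : C) (p q : {poly C}).

Lemma horner_upper p n x : (size p <= n.+1)%N -> 1 <= cabs x ->
  cabs p.[x] <= (\sum_(i < n.+1) cabs p`_i) * cabs x ^+ n.
Proof.
move=> sp x1; rewrite (horner_coef_wide _ sp) mulr_suml.
apply: le_trans (cabs_sum _ _ _) _; apply: ler_sum => i _.
rewrite cabsM cabsX ler_wpM2l ?cabs_ge0 // ler_weXn2l //.
by rewrite -ltnS ltn_ord.
Qed.

Lemma horner_lower q : q != 0 -> exists c B : R, [/\ 0 < c, 1 <= B &
  forall x, B <= cabs x -> c * cabs x ^+ (size q).-1 <= cabs q.[x]].
Proof.
move=> q0; pose d := (size q).-1; pose S := \sum_(i < d) cabs q`_i.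
have S0 : 0 <= S by apply: sumr_ge0 => i _; exact: cabs_ge0.
have sq : size q = d.+1 by rewrite /d prednK // size_poly_gt0.
have l0 : 0 < cabs q`_d by rewrite cabs_gt0 -[q`_d]/(lead_coef q) lead_coef_eq0.
(* Beyond this radius the lower terms amount to at most half of the leading one. *)
exists (cabs q`_d / 2), (Num.max 1 (2 * S / cabs q`_d)); split.
- by rewrite divr_gt0.
- by rewrite le_max lexx.
move=> x; rewrite ge_max => /andP[x1]; rewrite ler_pdivrMr // => xS.
have x0 : 0 < cabs x by apply: lt_le_trans x1.
rewrite horner_coef sq big_ord_recr /= addrC.
have h1 : cabs (\sum_(i < d) q`_i * x ^+ i) * cabs x <= S * cabs x ^+ d.
  rewrite mulr_suml.
  have := ler_wpM2r (ltW x0) (cabs_sum (index_enum 'I_d) xpredT (fun i : 'I_d => q`_i * x ^+ i)).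
  move=> /le_trans; apply; rewrite mulr_suml; apply: ler_sum => i _.
  by rewrite cabsM cabsX -mulrA -exprSr ler_wpM2l ?cabs_ge0 // ler_weXn2l.
have h2 : S * cabs x ^+ d <= cabs q`_d / 2 * cabs x ^+ d * cabs x.
  rewrite [leRHS]mulrAC ler_pM2r ?exprn_gt0 //; lra.
have h3 : cabs (\sum_(i < d) q`_i * x ^+ i) <= cabs q`_d / 2 * cabs x ^+ d.
  by rewrite -(ler_pM2r x0); exact: le_trans h1 h2.
apply: le_trans (_ : cabs (q`_d * x ^+ d) - cabs (\sum_(i < d) q`_i * x ^+ i) <= _); last exact: cabsBr.
by rewrite cabsM cabsX; lra.
Qed.

Lemma wpf_large M e a (B : R) : subgroup M -> udiscrete M e -> M a ->
  exists2 r : R, 0 < r & forall z, z != 0 -> cabs z <= r -> B < cabs (wpf M (a + z)).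
Proof.
move=> sM ue Ma; have [g hg eg] := wpf_pole sM ue.
have [r r0 hr] := ana_cvg hg ltr01.
(* |z^-2| >= T exceeds [B] by more than the bound |g(0)| + 1 on the regular part. *)
pose T := `|B| + cabs (g 0) + 2.
have T0 : 2 <= T by rewrite /T lerDr addr_ge0 // cabs_ge0.
have T1 : 0 < T by lra.
exists (Num.min r T^-1); first by rewrite lt_min r0 invr_gt0.
move=> z z0; rewrite le_min => /andP[/hr h1 h2].
rewrite addrC (wpf_periodic z sM ue Ma) eg; rewrite add0r in h1.
have cz : 0 < cabs z by rewrite cabs_gt0.
have hg1 : cabs (g z) <= cabs (g 0) + 1.
  by have := cabsD (g z - g 0) (g 0); rewrite subrK; lra.
have h3 : cabs (z ^+ 2 * g z) <= cabs (g 0) + 1.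
  rewrite cabsM cabsX -[leRHS]mul1r ler_pM ?cabs_ge0 ?exprn_ge0 ?cabs_ge0 //.
  rewrite exprn_ile1 // ?cabs_ge0 // (le_trans h2) // invf_le1 //; lra.
have h4 : T <= cabs (z ^- 2).
  rewrite cabsV cabsX -exprVn.
  have : T <= (cabs z)^-1 by rewrite -[T]invrK lef_pV2 ?posrE ?invr_gt0.
  move: (_^-1) => t Tt; rewrite expr2; nra.
have := cabsBr (z ^- 2) (z ^+ 2 * g z).
have := ler_norm B; rewrite /T in h4; lra.
Qed.

(** Were wp locally constant at [u0], this would spread over the plane by [clopen_all]; it cannot
    stop at a point of [M], near which wp is large. Since [P] includes being off [M], reaching [P 0]
    is absurd. *)
Lemma wpf_isolated M e u0 : subgroup M -> udiscrete M e -> ~ M u0 ->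
  exists2 r : R, 0 < r & forall z, z != 0 -> cabs z <= r -> wpf M (u0 + z) <> wpf M u0.
Proof.
move=> sM ue Mu0; have [s hs s0] := wpf_ana sM ue Mu0.
have [[r r0 hr]|[r r0 hr]] := germ_isolated hs; last first.
  by exists r => // z z0 zr; rewrite -s0; exact: hr.
exfalso; rewrite s0 in hr; move: hr; set k := wpf M u0 => hr.
pose P u := ~ M u /\ exists2 r : R, 0 < r & forall z, cabs z <= r -> wpf M (u + z) = k.
suff : P 0 by case=> /(_ sM.1).
apply: (@clopen_all _ _ u0) => [|u [Mu [q q0 hq]]|u hu].
- split=> //; exists r => // z zr.
  by have [->|z0] := eqVneq z 0; [rewrite addr0|exact: hr].
- have [q' q'0 hq'] := udiscrete_isolated u sM ue.
  exists (Num.min (q / 2) q'); first by rewrite lt_min divr_gt0.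
  move=> z; rewrite le_min => /andP[z1 z2]; split.
    by have [->|z0] := eqVneq z 0; [rewrite addr0|exact: hq'].
  exists (q / 2); first by rewrite divr_gt0.
  move=> y yq; rewrite -addrA; apply: hq; apply: le_trans (cabsD _ _) _; lra.
have Pk z : P (u + z) -> wpf M (u + z) = k.
  by move=> [_ [q q0 hq]]; rewrite -[u + z]addr0 hq // cabs0 ltW.
have Mu : ~ M u.
  move=> Mu; have [q q0 hq] := wpf_large (cabs k) sM ue Mu.
  have [z zq Pz] := hu q q0.
  have z0 : z != 0 by apply/eqP => z0; move: Pz => [+ _]; rewrite z0 addr0.
  by have := hq z z0 zq; rewrite (Pk _ Pz) ltxx.
have au := wpf_ana sM ue Mu.
have uk : wpf M u = k.
  apply/eqP; rewrite eq_sym -subr_eq0 -cabs_eq0 eq_le cabs_ge0 andbT.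
  apply/ler_addgt0Pr => d d0; rewrite add0r; have [q q0 hq] := ana_cvg au d0.
  by have [z zq /Pk <-] := hu q q0; exact/ltW/hq.
have [t ht t0] := au.
have [[q q0 hq]|[q q0 hq]] := germ_isolated ht.
  split=> //; exists q => // z zq.
  by have [->|z0] := eqVneq z 0; [rewrite addr0|rewrite hq // t0].
have [z zq Pz] := hu q q0; have [z0|z0] := eqVneq z 0; first by rewrite -[u]addr0 -z0.
by case: (hq z z0 zq); rewrite (Pk _ Pz) t0.
Qed.

(** At a pole the leading term of [p] dominates. Elsewhere the root wp(a) is divided out with its
    multiplicity: the power is nonzero by [wpf_isolated], the cofactor by continuity. *)
Lemma horner_wpf_neq0 M e p a : subgroup M -> udiscrete M e -> p != 0 ->
  exists2 r : R, 0 < r & forall z, z != 0 -> cabs z <= r -> p.[wpf M (a + z)] != 0.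
Proof.
move=> sM ue p0; have [Ma|Ma] := pselect (M a).
  have [c [B [c0 B1 hB]]] := horner_lower p0.
  have [r r0 hr] := wpf_large B sM ue Ma; exists r => // z z0 zr.
  have h := hr z z0 zr; rewrite -cabs_gt0; apply: lt_le_trans (hB _ (ltW h)).
  by rewrite mulr_gt0 // exprn_gt0 //; lra.
have [n [q hq pE]] := multiplicity_XsubC p (wpf M a).
rewrite p0 /= in hq.
have [r r0 hr] := wpf_isolated sM ue Ma.
have aq := ana_horner q (wpf_ana sM ue Ma).
have q0 : 0 < cabs q.[wpf M a] by rewrite cabs_gt0 -rootE.
have [r' r'0 hr'] := ana_cvg aq q0.
exists (Num.min r r'); first by rewrite lt_min r0.
move=> z z0; rewrite le_min => /andP[/(hr z z0) h1 /hr' h2].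
rewrite pE hornerM horner_exp hornerXsubC mulf_neq0 ?expf_neq0 ?subr_eq0 //; last exact/eqP.
by apply: contraTneq h2 => ->; rewrite sub0r cabsN ltxx.
Qed.

End Values.

(** * Finite values of rational functions *)

Section RationalFunctionValues.
Variable F : fieldType.
Implicit Types (f g : {fraction {poly F}}) (p q : {poly F}) (x y a b : F).

Local Notation tofrac := (@FracField.tofrac {poly F}).

Lemma fraction_repr f : f = tofrac (frac (repr f)).1 / tofrac (frac (repr f)).2.
Proof.
have d0 : (frac (repr f)).2 != 0 by exact: denom_ratioP.
have t0 : (tofrac (frac (repr f)).2 : {fraction {poly F}}) != 0 by rewrite tofrac_eq0.
apply: (canRL (mulfK t0)).
rewrite -[X in X * _]reprK -[GRing.mul]/(@FracField.mul {poly F}) !piE.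
apply/eqmodP; rewrite /= FracField.equivfE /FracField.mulf.
have n1 : (1 : {poly F}) != 0 := oner_neq0 _.
by rewrite !numden_Ratio ?mulf_neq0 // !mulr1 mulrC.
Qed.

Lemma ratnum_ratden f :
  [/\ ratden f != 0, coprimep (ratnum f) (ratden f) & f = tofrac (ratnum f) / tofrac (ratden f)].
Proof.
rewrite /ratnum /ratden; have := fraction_repr f.
have := denom_ratioP (repr f).
set P := (frac (repr f)).1; set Q := (frac (repr f)).2 => d0 fE.
pose h := gcdp P Q.
have h0 : h != 0 by rewrite gcdp_eq0 negb_and d0 orbT.
have eP : P = P %/ h * h by rewrite divpK // dvdp_gcdl.
have eQ : Q = Q %/ h * h by rewrite divpK // dvdp_gcdr.
have Q0 : Q %/ h != 0 by apply: contraNneq d0 => e; rewrite eQ e mul0r.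
split=> //; first by apply: coprimep_div_gcd; rewrite d0 orbT.
rewrite [LHS]fE {1}eP {1}eQ !rmorphM /= -mulf_div divff ?mulr1 //.
by rewrite tofrac_eq0.
Qed.

(* Unlike rateval, this does not refer to the reduced representation of f, which
   makes compatibility with the field operations immediate. *)
Definition ratval f x a : Prop :=
  exists p q, [/\ q.[x] != 0, f = tofrac p / tofrac q & a = p.[x] / q.[x]].

Lemma horner_neq0 q x : q.[x] != 0 -> q != 0.
Proof. by apply: contraNneq => ->; rewrite horner0. Qed.

Lemma ratval_const c x : ratval (ratconst c) x c.
Proof.
exists c%:P, 1; rewrite !hornerE oner_neq0; split=> //; last by rewrite divr1.
by rewrite rmorph1 divr1.
Qed.

Lemma ratvalD f g x a b : ratval f x a -> ratval g x b -> ratval (f + g) x (a + b).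
Proof.
move=> [p [q [q0 -> ->]]] [r [s [s0 -> ->]]].
exists (p * s + r * q), (q * s); rewrite !hornerE mulf_neq0 //.
split=> //; last by rewrite addf_div.
by rewrite rmorphD !rmorphM /= addf_div // tofrac_eq0 ?(horner_neq0 q0) ?(horner_neq0 s0).
Qed.

Lemma ratvalM f g x a b : ratval f x a -> ratval g x b -> ratval (f * g) x (a * b).
Proof.
move=> [p [q [q0 -> ->]]] [r [s [s0 -> ->]]].
exists (p * r), (q * s); rewrite !hornerM mulf_neq0 //.
by split=> //; [rewrite !rmorphM /= -mulf_div|rewrite mulf_div].
Qed.

Lemma ratvalN f x a : ratval f x a -> ratval (- f) x (- a).
Proof.
move=> /(ratvalM (ratval_const (-1) x)); rewrite mulN1r.
by rewrite {1}/ratconst !rmorphN !rmorph1 mulN1r.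
Qed.

Lemma ratvalV f x a : a != 0 -> ratval f x a -> ratval f^-1 x a^-1.
Proof.
move=> a0 [p [q [q0 -> ea]]]; rewrite ea in a0 *.
exists q, p; split; rewrite ?invf_div //.
by apply: contraNneq a0 => ->; rewrite mul0r.
Qed.

Lemma ratval_horner p g x y : ratval g x y -> ratval (map_poly (@ratconst F) p).[g] x p.[y].
Proof.
move=> hg; rewrite /map_poly horner_poly horner_coef.
have hX n : ratval (g ^+ n) x (y ^+ n).
  elim: n => [|n IH]; last by rewrite !exprS; exact: ratvalM.
  by rewrite !expr0; have := ratval_const 1 x; rewrite /ratconst !rmorph1.
elim/big_rec2: _ => [|i a f _ h].
  by have := ratval_const 0 x; rewrite /ratconst !rmorph0.
by apply: (ratvalD _ h); apply: ratvalM; [exact: ratval_const|exact: hX].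
Qed.

Lemma ratval_comp f g x y : (ratden f).[y] != 0 -> ratval g x y ->
  ratval (ratcomp f g) x ((ratnum f).[y] / (ratden f).[y]).
Proof.
move=> d0 hg; apply: ratvalM; first exact: ratval_horner.
by apply: ratvalV => //; exact: ratval_horner.
Qed.

(** The numerator of f - g vanishes on [S], which no nonzero polynomial does. *)
Lemma ratval_inj f g (S : F -> Prop) :
  (forall p, p != 0 -> exists2 x, S x & p.[x] != 0) ->
  (forall x, S x -> exists2 a, ratval f x a & ratval g x a) -> f = g.
Proof.
move=> hS hfg; apply/eqP; rewrite -subr_eq0; apply/negPn/negP => h0.
have [d0 _ fE] := ratnum_ratden (f - g).
have n0 : ratnum (f - g) != 0.
  by apply: contraNneq h0 => n0; rewrite fE n0 rmorph0 mul0r.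
have [x Sx] := hS _ n0; have [a ha hb] := hfg x Sx.
have [p [q [q0 e]]] := ratvalD ha (ratvalN hb).
rewrite subrr => /esym/eqP; rewrite mulf_eq0 invr_eq0 (negbTE q0) orbF => /eqP p0.
have : ratnum (f - g) * q = p * ratden (f - g).
  apply/eqP; rewrite -tofrac_eq !rmorphM /= -eqr_div ?tofrac_eq0 //.
    by rewrite -fE e.
  exact: horner_neq0 q0.
move=> /(congr1 (horner^~ x)); rewrite !hornerM p0 mul0r => /eqP.
by rewrite mulf_eq0 (negbTE q0) orbF => /eqP ->; rewrite eqxx.
Qed.

End RationalFunctionValues.

(** * Existence and composition of the maps R_{M:N} *)

Section QuotientMaps.
Variable R : realType.
Local Notation C := (R[i]).
Implicit Types (L M N : set C) (u v w x y z : C) (p q : {poly C}).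

(* At the zeros of Q(wp_N) the relation follows by continuity, these zeros being
   isolated. *)
Lemma coprime_relation M N e p q P Q : subgroup M -> subgroup N -> udiscrete M e -> N `<=` M ->
  Q != 0 -> (forall u, ~ M u -> Q.[wpf N u] * wpf M u = P.[wpf N u]) ->
  coprimep p q -> q != 0 -> p * Q = P * q ->
  forall u, ~ M u -> q.[wpf N u] != 0 /\ p.[wpf N u] = wpf M u * q.[wpf N u].
Proof.
move=> sM sN ue NM Q0 hPQ cpq q0 epq u Mu.
have ueN : udiscrete N e by split=> [|y Ny]; [exact: ue.1|apply: ue.2; exact: NM].
have Nu : ~ N u by move=> /NM.
suff e1 : p.[wpf N u] = wpf M u * q.[wpf N u].
  split=> //; apply/negP => qu; have pu : p.[wpf N u] == 0 by rewrite e1 (eqP qu) mulr0.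
  by have := coprimep_root cpq pu; rewrite (eqP qu) eqxx.
pose f u := wpf M u * q.[wpf N u] - p.[wpf N u].
have aN := wpf_ana sN ueN Nu.
have af : ana f u by apply: anaB (ana_horner p aN); apply: anaM (ana_horner q aN); exact: (wpf_ana sM ue).
have [r r0 hr] := horner_wpf_neq0 u sN ueN Q0.
have [r' r'0 hr'] := udiscrete_isolated u sM ue.
apply/eqP; rewrite eq_sym -subr_eq0 -/(f u) -cabs_eq0 eq_le cabs_ge0 andbT.
apply/ler_addgt0Pr => d d0; rewrite add0r; have [s s0 hs] := ana_cvg af d0.
have m0 : 0 < Num.min s (Num.min r r') by rewrite !lt_min s0 r0.
have [z z0 ez] := cabs_exists m0.
have : cabs z <= Num.min s (Num.min r r') by rewrite ez.
rewrite !le_min => /and3P[/hs h1 /(hr z z0) h2 /(hr' z z0) h3].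
have fz : f (u + z) = 0.
  apply: (mulfI h2); rewrite mulr0 /f mulrBr mulrA hPQ //.
  have := congr1 (horner^~ (wpf N (u + z))) epq; rewrite !hornerM => <-.
  by rewrite mulrC subrr.
by move: h1; rewrite fz sub0r cabsN => /ltW.
Qed.

Lemma ratR_spec M N e v w : subgroup M -> subgroup N -> udiscrete M e -> N `<=` M ->
  N v -> N w -> Rindep v w ->
  forall u, rateval (ratR M N) (wp N u) = wp M u.
Proof.
move=> sM sN ue NM Nv Nw hvw.
have ueN : udiscrete N e by split=> [|y Ny]; [exact: ue.1|apply: ue.2; exact: NM].
have [rs [urs rsM rsc rsi]] := coset_representatives sM sN ue NM Nv Nw hvw.
have [Q Q0 [P hPQ]] := wpf_relation sM sN ue NM urs rsM rsc rsi Nv Nw hvw.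
pose f : {fraction {poly C}} := FracField.tofrac P / FracField.tofrac Q.
(* Once one function has the defining property, so has the one selected by [xget]. *)
suff hf : forall u, rateval f (wp N u) = wp M u.
  suff : [set g : {fraction {poly C}} | forall u, rateval g (wp N u) = wp M u] (ratR M N) by [].
  by apply: xgetPex; exists f.
have [q0 cpq fE] := ratnum_ratden f.
have epq : ratnum f * Q = P * ratden f.
  apply/eqP; rewrite -tofrac_eq !rmorphM /= -eqr_div ?tofrac_eq0 //.
  by rewrite -fE.
rewrite /rateval; move: q0 cpq epq; set p := ratnum f; set q := ratden f => q0 cpq epq.
have key := coprime_relation sM sN ue NM Q0 hPQ cpq q0 epq.
move=> u; rewrite (wpE _ sN ueN) (wpE _ sM ue).
have [Mu|Mu] := pselect (M u); last first.
  have [h1 h2] := key u Mu; rewrite !memNset // => [|/NM//].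
  by rewrite (negbTE h1) h2 mulfK.
rewrite (mem_set Mu); have [r r0 hr] := udiscrete_isolated u sM ue.
have [Nu|Nu] := pselect (N u).
  (* Both functions have a pole here. With deg p <= deg q the quotient p/q would stay bounded as
     wp_N tends to infinity, whereas wp_M does not. *)
  rewrite (mem_set Nu); case: ltnP => // sqp; exfalso.
  have sq : size q = (size q).-1.+1 by rewrite prednK // size_poly_gt0.
  have [c [B [c0 B1 hB]]] := horner_lower q0.
  pose S := \sum_(i < (size q).-1.+1) cabs p`_i.
  have [r1 r10 hr1] := wpf_large B sN ueN Nu.
  have [r2 r20 hr2] := wpf_large (S / c) sM ue Mu.
  have m0 : 0 < Num.min r (Num.min r1 r2) by rewrite !lt_min r0 r10.
  have [z z0 ez] := cabs_exists m0.
  have : cabs z <= Num.min r (Num.min r1 r2) by rewrite ez.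
  rewrite !le_min => /and3P[/(hr z z0) h1 /(hr1 z z0) h2 /(hr2 z z0)].
  have [_] := key _ h1; move: h2; set x := wpf N _; set y := wpf M _ => h2 e1.
  rewrite ltr_pdivrMr // => h3.
  have x1 : 1 <= cabs x by lra.
  have sp : (size p <= (size q).-1.+1)%N by rewrite -sq.
  have := horner_upper sp x1; rewrite e1 cabsM -/S => h4.
  have h5 := hB x (ltW h2).
  have X0 : 0 < cabs x ^+ (size q).-1 by apply: exprn_gt0; apply: lt_le_trans x1.
  have := le_trans (ler_wpM2l (cabs_ge0 y) h5) h4.
  by rewrite mulrA ler_pM2r // leNgt h3.
(* At a point of [M] off [N], wp_N is finite while wp_M is unbounded nearby; a nonzero value of [q]
   would keep p/q bounded. *)
rewrite (memNset Nu); case: eqP => // /eqP qu; exfalso.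
have aN := wpf_ana sN ueN Nu.
have cq : 0 < cabs q.[wpf N u] by rewrite cabs_gt0.
have cq2 : 0 < cabs q.[wpf N u] / 2 by rewrite divr_gt0.
have [r1 r10 hr1] := ana_cvg (ana_horner q aN) cq2.
have [r3 r30 hr3] := ana_cvg (ana_horner p aN) ltr01.
have [r2 r20 hr2] := wpf_large ((cabs p.[wpf N u] + 1) / (cabs q.[wpf N u] / 2)) sM ue Mu.
have m0 : 0 < Num.min (Num.min r r3) (Num.min r1 r2) by rewrite !lt_min r0 r10 r30.
have [z z0 ez] := cabs_exists m0.
have : cabs z <= Num.min (Num.min r r3) (Num.min r1 r2) by rewrite ez.
rewrite !le_min => /andP[/andP[/(hr z z0) h1 /hr3 h4] /andP[/hr1 h2 /(hr2 z z0)]].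
have [_ e1] := key _ h1; rewrite ltr_pdivrMr // => h3.
have := cabsD (p.[wpf N (u + z)] - p.[wpf N u]) p.[wpf N u]; rewrite subrK {1}e1 cabsM.
have := cabsBr q.[wpf N u] (q.[wpf N (u + z)] - q.[wpf N u]).
rewrite (addrC q.[wpf N u]) subrK => h5 h6.
have h7 : cabs q.[wpf N u] / 2 <= cabs q.[wpf N (u + z)] by lra.
have := ler_wpM2l (cabs_ge0 (wpf M (u + z))) h7; lra.
Qed.

Lemma rateval_ratval f x a : rateval f (Some x) = Some a ->
  [/\ (ratden f).[x] != 0, a = (ratnum f).[x] / (ratden f).[x] & @ratval C f x a].
Proof.
rewrite /rateval; case: eqP => // /eqP d0 [<-]; split=> //.
by exists (ratnum f), (ratden f); have [_ _ fE] := ratnum_ratden f.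
Qed.

(** Off [L] all three functions are finite, and both sides take the value wp_L(u) at wp_N(u). By
    [horner_wpf_neq0] every nonzero polynomial is nonzero at one of these points. *)
Lemma ratR_comp L M N e v w : subgroup L -> subgroup M -> subgroup N -> udiscrete L e ->
  M `<=` L -> N `<=` M -> N v -> N w -> Rindep v w ->
  ratR L N = ratcomp (ratR L M) (ratR M N).
Proof.
move=> sL sM sN ue ML NM Nv Nw hvw.
have ueM : udiscrete M e by split=> [|y My]; [exact: ue.1|apply: ue.2; exact: ML].
have ueN : udiscrete N e by split=> [|y Ny]; [exact: ue.1|apply: ueM.2; exact: NM].
have NL : N `<=` L by move=> y /NM/ML.
have hLN := ratR_spec sL sN ue NL Nv Nw hvw.
have hLM := ratR_spec sL sM ue ML (NM _ Nv) (NM _ Nw) hvw.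
have hMN := ratR_spec sM sN ueM NM Nv Nw hvw.
apply: (@ratval_inj _ _ _ (fun x => exists2 u, ~ L u & x = wpf N u)) => [p p0|x [u Lu ->]].
  have [r r0 hr] := horner_wpf_neq0 0 sN ueN p0.
  have [r' r'0 hr'] := udiscrete_isolated 0 sL ue.
  have m0 : 0 < Num.min r r' by rewrite lt_min r0.
  have [z z0 ez] := cabs_exists m0.
  have : cabs z <= Num.min r r' by rewrite ez.
  rewrite le_min => /andP[/(hr z z0) h1 /(hr' z z0) h2].
  by exists (wpf N (0 + z)) => //; exists (0 + z).
have Mu : ~ M u by move=> /ML.
have Nu : ~ N u by move=> /NM.
have := hLN u; have := hLM u; have := hMN u.
rewrite (wpE _ sN ueN) (wpE _ sM ueM) (wpE _ sL ue) !memNset //.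
move=> /rateval_ratval[_ _ h1] /rateval_ratval[d0 e1 _] /rateval_ratval[_ _ h3].
exists (wpf L u) => //; rewrite e1; exact: ratval_comp.
Qed.

End QuotientMaps.

Theorem mainTheorem2 (R : realType) (L L1 L2 : set R[i]) :
  rank2_lattice L ->
  full_rank_sublattice L1 L ->
  full_rank_sublattice L2 L ->
  L1 <> L2 ->
  let L12 := L1 `&` L2 in
  [/\ full_rank_sublattice L12 L1,
      full_rank_sublattice L12 L2,
      ratR L L12 = ratcomp (ratR L L1) (ratR L1 L12) &
      ratR L L12 = ratcomp (ratR L L2) (ratR L2 L12)].
Proof.
move=> rL [s1 L1L r1] [s2 L2L r2] _ L12.
have [sL _ hL] := rL; have [e ue] := rank2_udiscrete rL.
have s12 : subgroup L12 := subgroupI s1 s2.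
have i1 : L12 `<=` L1 by move=> u [].
have i2 : L12 `<=` L2 by move=> u [].
have r12 : has_rank 2 L12 := has_rank2I s1 s2 L1L L2L hL r1 r2.
have [[v Lv vi] _] := r12.
(* The discreteness of [L] turns independence over the integers into independence over the reals;
   this one pair in [L12] serves both compositions. *)
have hvw := Zindependent_Rindep sL ue (fun i => L1L _ (i1 _ (Lv i))) vi.
split; [by split|by split| |].
- exact: ratR_comp sL s1 s12 ue L1L i1 (Lv _) (Lv _) hvw.
- exact: ratR_comp sL s2 s12 ue L2L i2 (Lv _) (Lv _) hvw.
Qed.
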